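(* Let $q\geq 2$ and $n\geq 1$. Then there is a homeomorphism \[\mathrm{Hom}(F_n/\Gamma^{q+1}_n,SU(2))\cong \mathrm{Hom}(\mathbb{Z}^n,SU(2))\sqcup \bigsqcup_{C(n,q+1)}PU(2)\] (a disjoint union with $C(n,q+1)$ copies of $PU(2)$), where \[C(n,q+1)=\frac{2^{n-2}(2^n-1)(2^{n-1}-1)}{3}+(2^n-1)\left(2^{(q-2)(n-1)}-1\right)2^{2n-3}.\]
   Context: $F_n$ is the free group on $n$ generators. The descending central series of a group $Q$ is $\Gamma^1(Q)=Q$, $\Gamma^{k+1}(Q)=[\Gamma^k(Q),Q]$, and $\Gamma^k_n:=\Gamma^k(F_n)$. For a discrete group $\Gamma$ and a topological group $G$, $\mathrm{Hom}(\Gamma,G)$ is the set of homomorphisms topologized as a subspace of $G^\Gamma$ with the product topology; for $\Gamma$ generated by $n$ elements this agrees with its topology as a subspace of $G^n$. $PU(2)=SU(2)/\{\pm I\}$. *)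

(* Defs.v *)
From HB Require Import structures.
From mathcomp Require Import all_boot all_order all_algebra.
From mathcomp Require Import generic_quotient spectral complex.
From mathcomp Require Import all_classical all_reals all_analysis.

Set Implicit Arguments.
Unset Strict Implicit.
Unset Printing Implicit Defensive.

Import Order.TTheory GRing.Theory Num.Theory.
Import numFieldNormedType.Exports.
Local Open Scope classical_set_scope.
Local Open Scope quotient_scope.

Section Subgroups.
Local Open Scope group_scope.

Definition is_subgroup (G : groupType) (H : set G) : Prop :=
  [/\ H 1, forall x y, H x -> H y -> H (x * y) & forall x, H x -> H x^-1].

Record normalSubgroup (G : groupType) := NormalSubgroup {
  ns_set : set G;
  ns_subgroup : is_subgroup ns_set;
  ns_conj : forall x g, ns_set x -> ns_set (x ^ g) }.

Definition generated (G : groupType) (A : set G) : set G :=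
  smallest (@is_subgroup G) A.

Definition commutator_subgroup (G : groupType) (A B : set G) : set G :=
  generated [set [~ a, b] | a in A & b in B].

(* Indexed from 1: [lcs_set G 1] is the whole group; [lcs_set G 0] is junk
   (also the whole group). *)
Definition lcs_set (G : groupType) (k : nat) : set G :=
  iter k.-1 (fun H => commutator_subgroup H [set: G]) [set: G].

Lemma generated_subgroup (G : groupType) (A : set G) :
  is_subgroup (generated A).
Proof.
split=> [B [[]]//|x y Hx Hy B AB|x Hx B AB].
  by case: (AB) => -[_ BM _] _; apply: BM; [exact: Hx|exact: Hy].
by case: (AB) => -[_ _ BV] _; apply: BV; exact: Hx.
Qed.

Lemma generated_conj (G : groupType) (A : set G) :
  (forall x g, A x -> A (x ^ g)) ->
  forall x g, generated A x -> generated A (x ^ g).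
Proof.
move=> AJ x g Ax.
have [g1 gM gV] := generated_subgroup A.
apply: (Ax [set y | generated A (y ^ g)]); split.
  split=> /= [|y z Hy Hz|y Hy]; first by rewrite conj1g.
    by rewrite conjMg; exact: gM.
  by rewrite conjVg; exact: gV.
by move=> y Ay /= B [_ AB]; exact/AB/AJ.
Qed.

Lemma lcs_subgroup (G : groupType) k : is_subgroup (@lcs_set G k).
Proof.
by rewrite /lcs_set; case: k.-1 => [|j]; [split|exact: generated_subgroup].
Qed.

Lemma lcs_conj (G : groupType) k (x g : G) :
  lcs_set k x -> lcs_set k (x ^ g).
Proof.
rewrite /lcs_set; elim: k.-1 x g => [//|j IH] /= x g.
apply: generated_conj => _ {}g [a Aa [b _ <-]].
by exists (a ^ g); [exact: IH|exists (b ^ g); rewrite // conjRg].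
Qed.

Definition lcs (G : groupType) (k : nat) : normalSubgroup G :=
  NormalSubgroup (@lcs_subgroup G k) (@lcs_conj G k).

End Subgroups.

Section Quotient.
Local Open Scope group_scope.
Context {G : groupType} (N : normalSubgroup G).

Definition coset_eq (x y : G) : bool := `[< ns_set N (x^-1 * y) >].

Lemma coset_eq_equiv : equiv_class_of coset_eq.
Proof.
have [N1 NM NV] := ns_subgroup N.
split=> [x|x y|y x z]; rewrite /coset_eq.
- by apply/asboolP; rewrite mulVg.
- by apply/asboolP/asboolP => /NV; rewrite invgM invgK.
- move=> /asboolP xy /asboolP yz; apply/asboolP.
  by have := NM _ _ xy yz; rewrite -mulgA mulVKg.
Qed.
Canonical coset_equivRel := EquivRelPack coset_eq_equiv.

Definition quotientGroup := {eq_quot coset_equivRel}.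
HB.instance Definition _ := Choice.on quotientGroup.
HB.instance Definition _ := EqQuotient.on quotientGroup.

Lemma cosetP (x y : G) :
  reflect (ns_set N (x^-1 * y)) (\pi_quotientGroup x == \pi_quotientGroup y).
Proof. by rewrite piE /=; exact: asboolP. Qed.

Definition quot_one : quotientGroup := \pi_quotientGroup (1 : G).
Definition quot_mul (a b : quotientGroup) : quotientGroup :=
  \pi_quotientGroup (repr a * repr b).
Definition quot_inv (a : quotientGroup) : quotientGroup :=
  \pi_quotientGroup (repr a)^-1.

Lemma reprQ (a : quotientGroup) : \pi_quotientGroup (repr a) = a.
Proof. exact: reprK. Qed.

Lemma repr_coset x : ns_set N (x^-1 * repr (\pi_quotientGroup x)).
Proof. by apply/cosetP; rewrite reprK. Qed.

Lemma pi_quot_mul x y :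
  quot_mul (\pi_quotientGroup x) (\pi_quotientGroup y)
  = \pi_quotientGroup (x * y).
Proof.
have [_ NM _] := ns_subgroup N.
apply/esym/eqP/cosetP.
have := NM _ _ (ns_conj y (repr_coset x)) (repr_coset y).
by rewrite /conjg invgM !mulgA mulgK.
Qed.

Lemma pi_quot_inv x :
  quot_inv (\pi_quotientGroup x) = \pi_quotientGroup x^-1.
Proof.
have [_ _ NV] := ns_subgroup N.
apply/esym/eqP/cosetP.
have := NV _ (ns_conj x^-1 (repr_coset x)).
by rewrite conjgE !invgK -mulgA mulVKg invgM !invgK.
Qed.

Lemma quot_mulA : associative quot_mul.
Proof.
by move=> x y z; rewrite -[x]reprQ -[y]reprQ -[z]reprQ !pi_quot_mul mulgA.
Qed.
Lemma quot_mul1 : left_id quot_one quot_mul.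
Proof. by move=> x; rewrite -[x]reprQ pi_quot_mul mul1g. Qed.
Lemma quot_mul1r : right_id quot_one quot_mul.
Proof. by move=> x; rewrite -[x]reprQ pi_quot_mul mulg1. Qed.
Lemma quot_mulV : left_inverse quot_one quot_inv quot_mul.
Proof. by move=> x; rewrite -[x]reprQ pi_quot_inv pi_quot_mul mulVg. Qed.
Lemma quot_mulVr : right_inverse quot_one quot_inv quot_mul.
Proof. by move=> x; rewrite -[x]reprQ pi_quot_inv pi_quot_mul mulgV. Qed.

HB.instance Definition _ := isGroup.Build quotientGroup
  quot_mulA quot_mul1 quot_mul1r quot_mulV quot_mulVr.

End Quotient.

Section FreeGroup.
Variable n : nat.

(* A letter [(i, b)] is the generator [x_i] if [b] is [true] and its inverse
   if [b] is [false]. *)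
Definition word := seq ('I_n * bool).

Definition flip (l : 'I_n * bool) : 'I_n * bool := (l.1, ~~ l.2).

Inductive word_cong : word -> word -> Prop :=
| wc_cancel u l v : word_cong (u ++ l :: flip l :: v) (u ++ v)
| wc_refl u : word_cong u u
| wc_sym u v : word_cong u v -> word_cong v u
| wc_trans u v w : word_cong u v -> word_cong v w -> word_cong u w.

Definition word_eq (u v : word) : bool := `[< word_cong u v >].

Lemma word_eq_equiv : equiv_class_of word_eq.
Proof.
split=> [u|u v|v u w]; rewrite /word_eq.
- exact/asboolP/wc_refl.
- by apply/asboolP/asboolP; exact: wc_sym.
- by move=> /asboolP uv /asboolP vw; apply/asboolP; exact: wc_trans vw.
Qed.
Canonical word_equivRel := EquivRelPack word_eq_equiv.

Definition freeGroup := {eq_quot word_equivRel}.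
HB.instance Definition _ := Choice.on freeGroup.
HB.instance Definition _ := EqQuotient.on freeGroup.

Definition free_gen (i : 'I_n) : freeGroup := \pi_freeGroup [:: (i, true)].

Lemma wordP (u v : word) :
  reflect (word_cong u v) (\pi_freeGroup u == \pi_freeGroup v).
Proof. by rewrite piE /=; exact: asboolP. Qed.

Lemma flipK : involutive flip.
Proof. by case=> i b; rewrite /flip /= negbK. Qed.

Definition word_inv (u : word) : word := rev (map flip u).

Lemma word_invK : involutive word_inv.
Proof.
by move=> u; rewrite /word_inv map_rev revK -map_comp map_id_in// => l _;
  exact: flipK.
Qed.

Lemma word_cong_cat u u' v v' :
  word_cong u u' -> word_cong v v' -> word_cong (u ++ v) (u' ++ v').
Proof.
move=> uu' vv'; apply: (@wc_trans _ (u' ++ v)).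
  elim: uu' v {vv'} => {u u'} [u l w v|u v|u w _ IH v|u w x _ IH1 _ IH2 v].
  - by rewrite -!catA /=; exact: wc_cancel.
  - exact: wc_refl.
  - exact/wc_sym/IH.
  - exact: wc_trans (IH1 v) (IH2 v).
elim: vv' => {u uu' v v'} [u l w|u|u w _ IH|u w x _ IH1 _ IH2].
- by rewrite !catA; exact: wc_cancel.
- exact: wc_refl.
- exact: wc_sym.
- exact: wc_trans IH1 IH2.
Qed.

Lemma word_cong_inv u v :
  word_cong u v -> word_cong (word_inv u) (word_inv v).
Proof.
elim=> {u v} [u l v|u|u v _ IH|u v w _ IH1 _ IH2].
- rewrite /word_inv !map_cat !rev_cat /= !rev_cons -!cats1 -!catA /=.
  by rewrite -{2}[flip l]flipK; exact: wc_cancel.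
- exact: wc_refl.
- exact: wc_sym.
- exact: wc_trans IH1 IH2.
Qed.

Lemma word_mulV u : word_cong (u ++ word_inv u) [::].
Proof.
elim: u => [|l u IH]; first exact: wc_refl.
rewrite /word_inv /= rev_cons -cats1 catA -cat1s.
apply: wc_trans (wc_cancel [::] l [::]).
apply: (word_cong_cat (wc_refl [:: l])).
exact: (word_cong_cat IH (wc_refl [:: flip l])).
Qed.

Lemma reprF (a : freeGroup) : \pi_freeGroup (repr a) = a.
Proof. exact: reprK. Qed.

Lemma repr_word u : word_cong u (repr (\pi_freeGroup u)).
Proof. by apply/wordP; rewrite reprK. Qed.

Definition free_one : freeGroup := \pi_freeGroup ([::] : word).
Definition free_mul (a b : freeGroup) : freeGroup :=
  \pi_freeGroup (repr a ++ repr b).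
Definition free_inv (a : freeGroup) : freeGroup :=
  \pi_freeGroup (word_inv (repr a)).

Lemma pi_free_mul u v :
  free_mul (\pi_freeGroup u) (\pi_freeGroup v) = \pi_freeGroup (u ++ v).
Proof.
apply/esym/eqP/wordP/word_cong_cat; exact: repr_word.
Qed.

Lemma pi_free_inv u :
  free_inv (\pi_freeGroup u) = \pi_freeGroup (word_inv u).
Proof.
exact/esym/eqP/wordP/word_cong_inv/repr_word.
Qed.

Lemma free_mulA : associative free_mul.
Proof.
by move=> x y z; rewrite -[x]reprF -[y]reprF -[z]reprF !pi_free_mul catA.
Qed.
Lemma free_mul1 : left_id free_one free_mul.
Proof. by move=> x; rewrite -[x]reprF pi_free_mul. Qed.
Lemma free_mul1r : right_id free_one free_mul.
Proof. by move=> x; rewrite -[x]reprF pi_free_mul cats0. Qed.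
Lemma free_mulVr : right_inverse free_one free_inv free_mul.
Proof.
move=> x; rewrite -[x]reprF pi_free_inv pi_free_mul.
exact/eqP/wordP/word_mulV.
Qed.
Lemma free_mulV : left_inverse free_one free_inv free_mul.
Proof.
move=> x; rewrite -[x]reprF pi_free_inv pi_free_mul.
apply/eqP/wordP.
by have := word_mulV (word_inv (repr x)); rewrite word_invK.
Qed.

HB.instance Definition _ := isGroup.Build freeGroup
  free_mulA free_mul1 free_mul1r free_mulV free_mulVr.

End FreeGroup.

(* The additive group Z^n, written multiplicatively. *)
Definition freeAbelian (n : nat) : groupType := Algebra.to_multiplicative 'rV[int]_n.

HB.mixin Record isTopologicalGroup G of Topological G & Group G := {
  mulg_continuous : continuous (fun p : G * G => (p.1 * p.2)%g);
  invg_continuous : continuous (fun x : G => x^-1%g) }.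

#[short(type="topologicalGroupType")]
HB.structure Definition TopologicalGroup :=
  {G of Topological G & Group G & isTopologicalGroup G}.

(* [Gamma] is discrete: all its homomorphisms are allowed.  The topology is
   the subspace topology inherited from the product topology on functions. *)
Definition HomSpace (Gamma : groupType) (G : topologicalGroupType) :=
  set_type [set f : {ptws Gamma -> G} | {morph f : x y / (x * y)%g}].
HB.instance Definition _ (Gamma : groupType) (G : topologicalGroupType) :=
  Topological.on (HomSpace Gamma G).

Definition homeomorphic (X Y : topologicalType) : Prop :=
  exists (f : X -> Y) (g : Y -> X),
    [/\ cancel f g, cancel g f, continuous f & continuous g].

(* The summand [X] has index [None], the copies of [Y] have indices [Some j]. *)
Definition disjoint_copies (X Y : topologicalType) (N : nat)
    (i : option 'I_N) : topologicalType :=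
  if i is Some _ then Y else X.
Definition disjoint_union_copies (X Y : topologicalType) (N : nat) :=
  {i : option 'I_N & disjoint_copies X Y i}.
HB.instance Definition _ (X Y : topologicalType) (N : nat) :=
  Topological.on (disjoint_union_copies X Y N).

Local Open Scope ring_scope.

(* The topology of the modulus: balls have radius in R[i], but 0 < r in R[i]
   forces r to be real. *)
HB.instance Definition _ (R : realType) := NormedModule.copy R[i] R[i]^o.

Section SU.
Variables (R : realType) (m : nat).
Local Notation C := R[i].

Definition in_SU : pred 'M[C]_m :=
  fun A => (A \is unitarymx) && (\det A == 1).

Record SU := MkSU { SU_val :> 'M[C]_m; SU_valP : in_SU SU_val }.

HB.instance Definition _ := [isSub for SU_val].
HB.instance Definition _ := [Choice of SU by <:].
HB.instance Definition _ := Topological.copy SU (initial_topology SU_val).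

End SU.

Section SUgroup.
Local Open Scope sesquilinear_scope.
Variables (R : realType) (m : nat).
Local Notation C := R[i].
Implicit Types A B : SU R m.

Lemma SU_unitary A : SU_val A \is unitarymx.
Proof. by case/andP: (SU_valP A). Qed.

Lemma SU_det A : \det (SU_val A) = 1.
Proof. by case/andP: (SU_valP A) => _ /eqP. Qed.

Lemma in_SU_one : in_SU (1%:M : 'M[C]_m).
Proof.
apply/andP; split; last by rewrite det1.
by apply/unitarymxP; rewrite trmx1 map_mx1 mulmx1.
Qed.

Lemma in_SU_mul A B : in_SU (SU_val A *m SU_val B).
Proof.
apply/andP; split; first by rewrite mul_unitarymx ?SU_unitary.
by rewrite det_mulmx !SU_det mulr1.
Qed.

Lemma in_SU_inv A : in_SU ((SU_val A) ^t*).
Proof.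
apply/andP; split; first by rewrite trmxC_unitary SU_unitary.
by rewrite det_map_mx det_tr SU_det rmorph1.
Qed.

Definition SU_one := MkSU in_SU_one.
Definition SU_mul A B := MkSU (in_SU_mul A B).
Definition SU_inv A := MkSU (in_SU_inv A).

Lemma SU_mulA : associative SU_mul.
Proof. by move=> A B D; apply: val_inj; rewrite /= mulmxA. Qed.
Lemma SU_mul1 : left_id SU_one SU_mul.
Proof. by move=> A; apply: val_inj; rewrite /= mul1mx. Qed.
Lemma SU_mul1r : right_id SU_one SU_mul.
Proof. by move=> A; apply: val_inj; rewrite /= mulmx1. Qed.
Lemma SU_mulVr : right_inverse SU_one SU_inv SU_mul.
Proof. by move=> A; apply/val_inj/unitarymxP/SU_unitary. Qed.
Lemma SU_mulV : left_inverse SU_one SU_inv SU_mul.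
Proof. by move=> A; apply/val_inj/mulmx1C/unitarymxP/SU_unitary. Qed.

HB.instance Definition _ := isGroup.Build (SU R m)
  SU_mulA SU_mul1 SU_mul1r SU_mulV SU_mulVr.

Lemma mx_continuous (T : topologicalType) (f : T -> 'M[C]_m) :
  (forall i j, continuous (fun x => f x i j)) -> continuous f.
Proof.
move=> fc x U [P fP PU].
suff : \forall y \near x, forall i j, P i j (f y i j).
  by apply: filterS => y Py; exact: PU.
have : \forall y \near x, forall ij : 'I_m * 'I_m, P ij.1 ij.2 (f y ij.1 ij.2).
  apply: filter_forall => -[i j]; exact: fc (fP i j).
by apply: filterS => y Py i j; exact: (Py (i, j)).
Qed.

Lemma SU_val_continuous : continuous (@SU_val R m).
Proof. exact: initial_continuous. Qed.

Lemma SU_coord_continuous i j : continuous (fun A : SU R m => SU_val A i j).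
Proof.
move=> A.
apply: (@continuous_comp _ _ _ (@SU_val R m) (fun M : 'M[C]_m => M i j)).
  exact: SU_val_continuous.
exact: (@coord_continuous C).
Qed.

Lemma SU_mul_continuous :
  continuous (fun p : SU R m * SU R m => (p.1 * p.2)%g).
Proof.
apply: continuous_comp_initial; apply: mx_continuous => i j.
under eq_fun do rewrite mxE.
move=> p; apply: cvg_big => [|k _]; first exact: add_continuous.
apply: cvgM.
  apply: (@continuous_comp _ _ _ fst (fun A => SU_val A i k)).
    exact: cvg_fst.
  exact: SU_coord_continuous.
apply: (@continuous_comp _ _ _ snd (fun A => SU_val A k j)).
  exact: cvg_snd.
exact: SU_coord_continuous.
Qed.

Lemma conjC_continuous : continuous (fun z : C => z^* ).
Proof.
move=> z; apply/(@cvgrPdist_lt C C C _ (nbhs_filter z)) => e e0; near=> w.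
rewrite -rmorphB norm_conjC; near: w.
by apply: (@near_ball C C z e e0).
Unshelve. all: by end_near. Qed.

Lemma SU_inv_continuous : continuous (fun A : SU R m => A^-1%g).
Proof.
apply: continuous_comp_initial; apply: mx_continuous => i j.
under eq_fun do rewrite !mxE.
move=> A.
apply: (@continuous_comp _ _ _ (fun A => SU_val A j i) (fun z : C => z^* )).
  exact: SU_coord_continuous.
exact: conjC_continuous.
Qed.

HB.instance Definition _ :=
  isTopologicalGroup.Build (SU R m) SU_mul_continuous SU_inv_continuous.

End SUgroup.

Section PU2.
Local Open Scope sesquilinear_scope.
Local Open Scope group_scope.
Variable R : realType.

Definition pm_one_set : set (SU R 2) :=
  [set A | SU_val A = 1%:M \/ SU_val A = - 1%:M].

Lemma pm_one_subgroup : is_subgroup pm_one_set.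
Proof.
rewrite /pm_one_set; split=> [|A B|A] /=; first by left.
  by case=> -> [] ->; rewrite ?mulNmx mul1mx ?opprK; (by left) || (by right).
case=> ->; [left|right].
  by rewrite trmx1 map_mx1.
by rewrite linearN /= map_mxN trmx1 map_mx1.
Qed.

Lemma pm_one_conj (A B : SU R 2) : pm_one_set A -> pm_one_set (A ^ B).
Proof.
have cE : SU_val (A ^ B) = SU_val B^-1 *m (SU_val A *m SU_val B) by [].
have VE : SU_val B^-1 *m SU_val B = 1%:M.
  by have := congr1 (@SU_val R 2) (mulVg B).
rewrite /pm_one_set /mkset cE => -[] ->; [left|right].
  by rewrite mul1mx VE.
by rewrite mulNmx mul1mx mulmxN VE.
Qed.

Definition pm_one : normalSubgroup (SU R 2) :=
  NormalSubgroup pm_one_subgroup pm_one_conj.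

Definition PU2 : topologicalType := quotient_topology (quotientGroup pm_one).

End PU2.

(* The closed formula for C(n, q + 1), valued in the rationals: for [n = 1] the
   exponents of 2 may be negative, but the total is then 0. *)
Definition component_count (n q : nat) : rat :=
  2 ^ (n%:Z - 2) * (2 ^ n%:Z - 1) * (2 ^ (n%:Z - 1) - 1) / 3
  + (2 ^ n%:Z - 1) * (2 ^ ((q%:Z - 2) * (n%:Z - 1)) - 1) * 2 ^ (2 * n%:Z - 3).

(* Main.v *)
(** A homomorphism from the free nilpotent quotient to SU(2) is either abelian, and
    then factors through Z^n, or it is not.  In the latter case let x be a noncentral
    value in the last noncentral term of the lower central series of the image.  All
    values commute with x up to sign, hence x has trace 0 and the image lies in the
    normaliser of the maximal torus through x; after conjugation the image contains
    j, and iterated commutators with j square torus elements, so that the image lies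
    in the generalised quaternion group of order 2^(q+1).  Conjugacy classes of such
    tuples have normal forms, i.e. words in a finite alphabet, which are counted by a
    linear recursion in n; the centraliser of a noncommuting tuple is {1, -1}, so that
    each orbit is a copy of PU(2).  The resulting continuous bijection from the
    disjoint union to the space of homomorphisms is a homeomorphism because its
    source is compact and its target is Hausdorff. *)
Require Import Defs.
From HB Require Import structures.
From mathcomp Require Import all_boot all_order all_algebra.
From mathcomp Require Import generic_quotient spectral complex.
From mathcomp Require Import all_classical all_reals all_analysis.
From mathcomp Require Import ring lra zify.
Set Implicit Arguments.
Unset Strict Implicit.
Unset Printing Implicit Defensive.
Import Order.TTheory GRing.Theory Num.Theory.
Import numFieldNormedType.Exports.
Local Open Scope classical_set_scope.
Local Open Scope quotient_scope.
Local Open Scope ring_scope.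

(** * Compact and Hausdorff spaces of homomorphisms *)

(** The two summands of C(n, q+1) reflect the one obstacle to a uniform normal form. A copy of Q_8
    meets three maximal tori in a group of order 4, none of them distinguished, whereas a larger
    image singles out one torus. The first summand equals (8^n - 3 * 4^n + 2 * 2^n) / 24: the
    numerator is the number of noncommuting n-tuples in Q_8, by inclusion-exclusion over its three
    cyclic subgroups of order 4, and 24 is the order of the normaliser of Q_8 in PU(2). For the
    group of order 2K with cyclic part of order K, and with the torus kept fixed, the normaliser is
    dihedral of order 2K and the same quotient is (2^n - 1)(K^n / K - 2^n / 2) / 2. The second
    summand is the difference of its values at K = 2^q and K = 4. These normalisers explain the
    constants but do not enter the argument: a normal form picks one tuple in each class by
    conditions on first letters, so that no group action has to be divided out. *)

Lemma compact_initial (S : choiceType) (T : topologicalType) (f : S -> T) :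
  compact (range f) -> compact [set: initial_topology f].
Proof.
move=> fK F FF FT.
have fF : (f @ F) (range f) by apply: (@filterS _ F _ [set: S]) => // x _; exists x.
have [_ [[x _ <-] xF]] := fK _ (fmap_proper_filter f FF) fF.
exists x; split => // A U FA [_ [[V oV <-] Vx] VU].
have fFA : (f @ F) (f @` A) by apply: (@filterS _ F _ A) => // y Ay; exists y.
have [_ [[y Ay <-] Vy]] := xF _ V fFA (open_nbhs_nbhs (conj oV Vx)).
by exists y; split => //; exact: VU.
Qed.

Lemma closed_coincidence (X Y : topologicalType) (f g : X -> Y) :
  hausdorff_space Y -> continuous f -> continuous g ->
  closed [set x | f x = g x].
Proof.
move=> hY fc gc x xc; apply: hY => U V fU gV.
have [y [/= fgy [Uy Vy]]] := xc _ (@filterI _ (nbhs x) _ _ _ (fc _ _ fU) (gc _ _ gV)).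
by exists (f y); split => //; rewrite fgy.
Qed.

Lemma hausdorff_separating (X : topologicalType) :
  (forall x y : X, x != y -> exists (Y : topologicalType) (f : X -> Y),
    [/\ hausdorff_space Y, continuous f & f x != f y]) -> hausdorff_space X.
Proof.
move=> sepX x y xy; apply/eqP/negPn/negP => /sepX [Y [f [hY fc /eqP]]]; apply.
apply: hY => U V fU fV.
by have [z [Uz Vz]] := xy _ _ (fc _ _ fU) (fc _ _ fV); exists (f z).
Qed.

Lemma continuous_bij_homeo (X Y : topologicalType) (f : X -> Y) :
  compact [set: X] -> hausdorff_space Y -> continuous f ->
  injective f -> (forall y, exists x, f x = y) -> homeomorphic X Y.
Proof.
move=> cX hY fc fI fS.
have [g gK] := boolp.choice fS.
exists f, g; split => //; first by move=> x; apply: fI.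
apply/continuous_closedP => C cC.
have -> : g @^-1` C = f @` C.
  rewrite eqEsubset; split => [y Cy|_ [x Cx <-]]; first by exists (g y).
  by rewrite /preimage /=; have -> : g (f x) = x by apply: fI.
apply: (compact_closed hY); apply: continuous_compact.
  exact: continuous_subspaceT.
exact: subclosed_compact cC cX _.
Qed.

Lemma homeomorphic_sym (X Y : topologicalType) :
  homeomorphic X Y -> homeomorphic Y X.
Proof. by move=> [f [g []]]; exists g, f. Qed.

Section HomSpaceTopology.
Variables (Gamma : groupType) (G : topologicalGroupType).

Lemma HomSpace_eval_continuous (x : Gamma) :
  continuous (fun f : HomSpace Gamma G => (\val f : Gamma -> G) x).
Proof.
move=> f.
apply: (@continuous_comp _ _ _ (\val : HomSpace Gamma G -> {ptws Gamma -> G})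
  (fun h => h x)).
  exact: (@initial_continuous _ _ (\val : HomSpace Gamma G -> {ptws Gamma -> G})).
exact: (@proj_continuous _ (fun=> G)).
Qed.

Lemma continuous_to_HomSpace (X : topologicalType) (f : X -> HomSpace Gamma G) :
  (forall x, continuous (fun t => (\val (f t) : Gamma -> G) x)) -> continuous f.
Proof.
move=> fc; apply: continuous_comp_initial => t.
apply/cvg_sup => x; exact: (continuous_comp_initial (fc x)).
Qed.

Lemma HomSpace_eq (f g : HomSpace Gamma G) :
  (forall x, (\val f : Gamma -> G) x = (\val g : Gamma -> G) x) -> f = g.
Proof. by move=> fg; apply/val_inj/funext. Qed.

Lemma HomSpace_hausdorff : hausdorff_space G -> hausdorff_space (HomSpace Gamma G).
Proof.
move=> hG; apply: hausdorff_separating => f g fg.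
have [x fgx] : exists x, (\val f : Gamma -> G) x != (\val g : Gamma -> G) x.
  apply: contrapT => fgE; case/eqP: fg; apply: HomSpace_eq => x.
  by apply: contrapT => fgx; apply: fgE; exists x; exact/eqP.
exists G, (fun h : HomSpace Gamma G => (\val h : Gamma -> G) x).
by split => //; exact: HomSpace_eval_continuous.
Qed.

(** Multiplicativity is one closed condition on $G^\Gamma$ for each pair of elements, and the
    product is compact by Tychonoff. *)
Lemma HomSpace_compact : hausdorff_space G -> compact [set: G] ->
  compact [set: HomSpace Gamma G].
Proof.
move=> hG cG; apply: compact_initial.
have -> : range (\val : HomSpace Gamma G -> {ptws Gamma -> G}) =
    [set f : {ptws Gamma -> G} | {morph f : x y / (x * y)%g}].
  rewrite eqEsubset; split => [_ [f _ <-]|f fM]; first exact: set_valP.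
  by exists (exist _ f (mem_set fM)).
have K : compact [set: {ptws Gamma -> G}].
  have -> : [set: {ptws Gamma -> G}] = [set f | forall i, [set: G] (f i)].
    by rewrite eqEsubset; split.
  exact: (@tychonoff Gamma (fun=> G) (fun=> setT) (fun=> cG)).
apply: (subclosed_compact _ K) => //.
have -> : [set f : {ptws Gamma -> G} | {morph f : x y / (x * y)%g}] =
   \bigcap_(p : Gamma * Gamma)
     [set f : {ptws Gamma -> G} | f (p.1 * p.2)%g = (f p.1 * f p.2)%g].
  rewrite eqEsubset; split => f /=; first by move=> fM p _; exact: fM.
  by move=> fM x y; exact: (fM (x, y)).
apply: closed_bigI => -[x y] _ /=.
have pc z : continuous (fun f : {ptws Gamma -> G} => f z).
  exact: (@proj_continuous _ (fun=> G)).
apply: (@closed_coincidence {ptws Gamma -> G} G (fun f => f (x * y)%g)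
  (fun f => (f x * f y)%g) hG); first exact: pc.
move=> f; apply: (@continuous_comp _ _ _ (fun f : {ptws Gamma -> G} => (f x, f y))
  (fun p : G * G => (p.1 * p.2)%g)); last exact: mulg_continuous.
exact: (cvg_pair (pc x f) (pc y f)).
Qed.

End HomSpaceTopology.

(** * The group SU(2) *)

Section SU2.
Local Open Scope sesquilinear_scope.
Variable R : realType.
Local Notation C := R[i].
Local Notation SU2 := (SU R 2).
Implicit Types (A B g h x y : SU2) (a b z : C).

(* A matrix of SU(2) is determined by its first row. *)
Definition su2_al A : C := SU_val A 0 0.
Definition su2_be A : C := SU_val A 0 1.

(** The quaternion [a + b j] as a matrix, where [j z = z^* j] for complex [z]. *)
Definition su2_mx a b : 'M[C]_2 :=
  \matrix_(i, j) if i == 0 then (if j == 0 then a else b)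
                 else (if j == 0 then - b^* else a^* ).

Lemma ord2P (P : 'I_2 -> Prop) : P 0 -> P 1 -> forall i, P i.
Proof.
move=> P0 P1 i; case: (unliftP ord0 i) => [j ->|->//].
by rewrite (ord1 j) (_ : lift ord0 0 = 1) //; exact/val_inj.
Qed.

Lemma mulmx2E (M N : 'M[C]_2) i j : (M *m N) i j = M i 0 * N 0 j + M i 1 * N 1 j.
Proof.
rewrite mxE big_ord_recl big_ord1; congr (_ + M i _ * N _ j); exact/val_inj.
Qed.

Lemma det_mx2E (M : 'M[C]_2) : \det M = M 0 0 * M 1 1 - M 0 1 * M 1 0.
Proof.
rewrite (expand_det_row _ 0) big_ord_recl big_ord1 /cofactor !det_mx11 !mxE /=.
rewrite expr0 expr1 mul1r mulN1r mulrN; congr (_ * M _ _ - M _ _ * M _ _);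
  exact/val_inj.
Qed.

Lemma SU_valE A : SU_val A = su2_mx (su2_al A) (su2_be A).
Proof.
have AV : SU_val A *m ((SU_val A) ^t* )%sesqui = 1%:M by apply/unitarymxP/SU_unitary.
have VA := mulmx1C AV.
have dA : SU_val A 0 0 * SU_val A 1 1 - SU_val A 0 1 * SU_val A 1 0 = 1.
  by rewrite -det_mx2E SU_det.
have e00 := congr1 (fun M : 'M[C]_2 => M 0 0) VA.
have e10 := congr1 (fun M : 'M[C]_2 => M 1 0) VA.
have e01 := congr1 (fun M : 'M[C]_2 => M 0 1) VA.
have e11 := congr1 (fun M : 'M[C]_2 => M 1 1) VA.
rewrite !mulmx2E !mxE /= in e00 e01 e10 e11.
apply/matrixP; apply: ord2P; apply: ord2P; rewrite !mxE //= /su2_al /su2_be.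
  move: (SU_val A) dA e00 e01 e10 e11 => M dA e00 e01 e10 e11.
  apply/eqP; rewrite -addr_eq0.
  (* In determinant 1 the conjugate transpose is the adjugate. This is one entry of that identity,
     as an explicit combination of the unitarity and determinant equations. *)
  have -> : M 1 0 + (M 0 1)^* =
      M 1 0 * (1 - ((M 0 1)^* * M 0 1 + (M 1 1)^* * M 1 1))
      + M 1 1 * ((M 0 1)^* * M 0 0 + (M 1 1)^* * M 1 0)
      + (M 0 1)^* * (1 - (M 0 0 * M 1 1 - M 0 1 * M 1 0)) by ring.
  by rewrite e11 e10 dA !subrr !mulr0 !addr0.
move: (SU_val A) dA e00 e01 e10 e11 => M dA e00 e01 e10 e11.
apply/eqP; rewrite -subr_eq0.
have -> : M 1 1 - (M 0 0)^* =
    M 1 1 * (1 - ((M 0 0)^* * M 0 0 + (M 1 0)^* * M 1 0))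
    + M 1 0 * ((M 0 0)^* * M 0 1 + (M 1 0)^* * M 1 1)
    - (M 0 0)^* * (1 - (M 0 0 * M 1 1 - M 0 1 * M 1 0)) by ring.
by rewrite e00 e01 dA !subrr !mulr0 addr0 subr0.
Qed.

Lemma su2_eq A B : su2_al A = su2_al B -> su2_be A = su2_be B -> A = B.
Proof. by move=> ea eb; apply: val_inj; rewrite /= !SU_valE ea eb. Qed.

Lemma su2_alM A B :
  su2_al (A * B)%g = su2_al A * su2_al B - su2_be A * (su2_be B)^*.
Proof. by rewrite {1}/su2_al /= mulmx2E [SU_val B]SU_valE !mxE /= mulrN. Qed.

Lemma su2_beM A B :
  su2_be (A * B)%g = su2_al A * su2_be B + su2_be A * (su2_al B)^*.
Proof. by rewrite {1}/su2_be /= mulmx2E [SU_val B]SU_valE !mxE. Qed.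

Lemma su2_alV A : su2_al A^-1%g = (su2_al A)^*.
Proof. by rewrite {1}/su2_al !mxE. Qed.

Lemma su2_beV A : su2_be A^-1%g = - su2_be A.
Proof. by rewrite {1}/su2_be /= [SU_val A]SU_valE !mxE /= rmorphN /= conjCK. Qed.

Lemma su2_al1 : su2_al 1%g = 1. Proof. by rewrite /su2_al mxE. Qed.
Lemma su2_be1 : su2_be 1%g = 0. Proof. by rewrite /su2_be mxE. Qed.

Lemma su2_norm A : su2_al A * (su2_al A)^* + su2_be A * (su2_be A)^* = 1.
Proof.
have := congr1 su2_al (mulgV A); rewrite su2_alM su2_alV su2_beV su2_al1.
by rewrite rmorphN mulrN opprK.
Qed.

Lemma su2_norm_al A : su2_be A = 0 -> su2_al A * (su2_al A)^* = 1.
Proof. by move=> h0; have := su2_norm A; rewrite h0 mul0r addr0. Qed.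

Lemma su2_norm_be A : su2_al A = 0 -> su2_be A * (su2_be A)^* = 1.
Proof. by move=> h0; have := su2_norm A; rewrite h0 mul0r add0r. Qed.

Lemma su2_mx_in_SU a b : a * a^* + b * b^* = 1 -> in_SU (su2_mx a b).
Proof.
move=> ab; apply/andP; split.
  apply/unitarymxP/matrixP; apply: ord2P; apply: ord2P;
    rewrite mulmx2E !mxE /= ?rmorphN /= ?conjCK ?mulr1n ?mulr0n -?ab; ring.
by rewrite det_mx2E !mxE /= -ab; apply/eqP; ring.
Qed.

Definition su2 a b : SU2 := insubd (1%g : SU2) (su2_mx a b).

Lemma su2_alE a b : a * a^* + b * b^* = 1 -> su2_al (su2 a b) = a.
Proof.
by move=> /su2_mx_in_SU ab; rewrite /su2_al /su2 (insubdK (1%g : SU2) ab) mxE.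
Qed.

Lemma su2_beE a b : a * a^* + b * b^* = 1 -> su2_be (su2 a b) = b.
Proof.
by move=> /su2_mx_in_SU ab; rewrite /su2_be /su2 (insubdK (1%g : SU2) ab) mxE.
Qed.

(* Locked: otherwise unification compares these constants entrywise. *)
Definition su2_m1 : SU2 := locked (su2 (-1) 0).
Definition su2_i : SU2 := locked (su2 'i 0).
Definition su2_j : SU2 := locked (su2 0 1).

Lemma su2_m1_al : su2_al su2_m1 = -1.
Proof. by rewrite /su2_m1 -lock su2_alE // rmorphN rmorph1 mulrNN mulr1 mul0r addr0. Qed.
Lemma su2_m1_be : su2_be su2_m1 = 0.
Proof. by rewrite /su2_m1 -lock su2_beE // rmorphN rmorph1 mulrNN mulr1 mul0r addr0. Qed.
Lemma su2_i_al : su2_al su2_i = 'i.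
Proof. by rewrite /su2_i -lock su2_alE // conjCi mulrN -expr2 sqrCi opprK mul0r addr0. Qed.
Lemma su2_i_be : su2_be su2_i = 0.
Proof. by rewrite /su2_i -lock su2_beE // conjCi mulrN -expr2 sqrCi opprK mul0r addr0. Qed.
Lemma su2_j_al : su2_al su2_j = 0.
Proof. by rewrite /su2_j -lock su2_alE // rmorph1 mulr1 mul0r add0r. Qed.
Lemma su2_j_be : su2_be su2_j = 1.
Proof. by rewrite /su2_j -lock su2_beE // rmorph1 mulr1 mul0r add0r. Qed.

Definition su2E := (su2_m1_al, su2_m1_be, su2_i_al, su2_i_be, su2_j_al, su2_j_be,
  su2_al1, su2_be1, su2_alM, su2_beM, su2_alV, su2_beV).

Definition su2_simpE := (@mul0r C, @mul1r C, @mulr0 C, @mulr1 C, @add0r C,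
  @addr0 C, @sub0r C, @subr0 C, @oppr0 C).

Lemma su2_m1C A : commute su2_m1 A.
Proof.
by apply: su2_eq; rewrite !su2E ?rmorphN ?rmorph0 ?rmorph1; ring.
Qed.

Lemma su2_m1_sq : (su2_m1 * su2_m1 = 1)%g.
Proof.
by apply: su2_eq; rewrite !su2E ?rmorphN ?rmorph0 ?rmorph1; ring.
Qed.

Lemma pm_one_setE A : pm_one_set A <-> A = 1%g \/ A = su2_m1.
Proof.
rewrite /pm_one_set /=; split.
  case=> AE; [left|right]; apply: su2_eq; rewrite ?su2E /su2_al /su2_be AE !mxE //=.
  by rewrite oppr0.
case=> ->; [by left|right]; rewrite SU_valE !su2E.
by apply/matrixP; apply: ord2P; apply: ord2P; rewrite !mxE //= ?rmorphN ?rmorph0 ?rmorph1 ?oppr0.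
Qed.

Lemma pm_oneP A : su2_be A = 0 -> (su2_al A)^* = su2_al A -> pm_one_set A.
Proof.
move=> b0 aR; apply/pm_one_setE; have := su2_norm A.
rewrite b0 mul0r addr0 aR -expr2 => /eqP; rewrite sqrf_eq1.
case/orP=> /eqP aE; [left|right]; apply: su2_eq; rewrite ?su2E //.
Qed.

(* Noncentral elements commute iff they lie on a common maximal torus. *)
Lemma su2_commute_trans h x y : ~ pm_one_set h ->
  commute h x -> commute h y -> commute x y.
Proof.
move=> hN hx hy.
(* The two equations say that the imaginary parts of the quaternions [A] and [B] are parallel. The
   imaginary part of the noncentral [h] is nonzero, so being parallel to it is transitive. *)
have com A B : commute A B <-> su2_be A * (su2_be B)^* = su2_be B * (su2_be A)^* /\
    (su2_al A - (su2_al A)^* ) * su2_be B = (su2_al B - (su2_al B)^* ) * su2_be A.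
  split=> [AB|[AB1 AB2]].
    have := congr1 su2_al AB; have := congr1 su2_be AB; rewrite !su2E => e1 e2.
    split; first by move: e2; rewrite [su2_al B * _]mulrC => /addrI/oppr_inj.
    rewrite !mulrBl; apply/eqP; rewrite subr_eq addrAC eq_sym subr_eq; apply/eqP.
    by rewrite [_^* * su2_be B]mulrC [_^* * su2_be A]mulrC e1.
  apply: su2_eq; rewrite !su2E; first by rewrite AB1; ring.
  apply/eqP; rewrite -subr_eq0; apply/eqP.
  by move/eqP: AB2; rewrite -subr_eq0 => /eqP <-; ring.
move: hx hy => /com[hx1 hx2] /com[hy1 hy2]; apply/com.
set u := su2_al h - _ in hx2 hy2.
have [b0|b0] := eqVneq (su2_be h) 0.
  have u0 : u != 0.
    apply/eqP => /eqP; rewrite subr_eq0 => /eqP aR; apply: hN.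
    by apply: pm_oneP => //; rewrite -aR.
  rewrite b0 !mulr0 in hx2 hy2.
  have /eqP := hx2; have /eqP := hy2.
  rewrite !mulf_eq0 (negPf u0) /= => /eqP -> /eqP ->.
  by split; rewrite ?mulr0 ?mul0r.
have ux : su2_al x - (su2_al x)^* = u * su2_be x / su2_be h.
  by rewrite hx2 mulfK.
have uy : su2_al y - (su2_al y)^* = u * su2_be y / su2_be h.
  by rewrite hy2 mulfK.
have vx : (su2_be x)^* = su2_be x * (su2_be h)^* / su2_be h.
  by rewrite -hx1 mulrAC mulfV // mul1r.
have vy : (su2_be y)^* = su2_be y * (su2_be h)^* / su2_be h.
  by rewrite -hy1 mulrAC mulfV // mul1r.
by split; rewrite ?ux ?uy ?vx ?vy; ring.
Qed.

End SU2.

(** * Imaginary units of SU(2) and their conjugacy *)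

Section SU2conj.
Variable R : realType.
Local Notation C := R[i].
Local Notation SU2 := (SU R 2).
Local Notation m1 := (su2_m1 R).
Local Notation iS := (su2_i R).
Local Notation jS := (su2_j R).
Implicit Types (A B g h x y : SU2) (a b z : C).

Definition su2_tr A : C := su2_al A + (su2_al A)^*.

Lemma su2_trC A B : su2_tr (A * B)%g = su2_tr (B * A)%g.
Proof. by rewrite /su2_tr !su2E !rmorphB !rmorphM /= !conjCK; ring. Qed.

Lemma su2_tr_conj A h : su2_tr (A ^ h)%g = su2_tr A.
Proof. by rewrite conjgE su2_trC mulgK. Qed.

(** Conjugation preserves the trace, whereas the sign reverses it. *)
Lemma su2_tr_anti x y : (x ^ y = m1 * x)%g -> su2_tr x = 0.
Proof.
move=> xy; have := su2_tr_conj x y.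
rewrite xy /su2_tr !su2E mul0r subr0 mulN1r rmorphN -opprD => /eqP.
by rewrite eq_sym -addr_eq0 -mulr2n mulrn_eq0 /= => /eqP.
Qed.

(** Cayley-Hamilton in determinant 1: x^2 - tr(x) x + 1 = 0. *)
Lemma su2_sq x : su2_tr x = 0 -> (x * x = m1)%g.
Proof.
move=> /eqP; rewrite /su2_tr addrC addr_eq0 => /eqP x0; apply: su2_eq; rewrite !su2E.
  by rewrite -(su2_norm x) x0; ring.
by rewrite x0; ring.
Qed.

(** The quaternion [1 + g] vanishes only for [g = m1]. Divided by its norm [sqrtC D] it becomes a
    unit quaternion, in fact a square root of [g]. *)
Lemma su2_half g : g <> m1 ->
  exists h r, SU_val h = r *: (1%:M + SU_val g).
Proof.
move=> gm1; set a := su2_al g; set b := su2_be g.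
pose D := (1 + a) * (1 + a)^* + b * b^*.
have D0 : 0 < D.
  rewrite lt_def addr_ge0 ?mul_conjC_ge0 // andbT.
  rewrite paddr_eq0 ?mul_conjC_ge0 // !mul_conjC_eq0.
  apply/negP => /andP[/eqP a0 /eqP b0]; apply: gm1; apply: su2_eq.
    by rewrite !su2E; apply/eqP; rewrite -addr_eq0 addrC a0.
  by rewrite !su2E.
pose r := (sqrtC D)^-1.
have rR : r^* = r.
  by apply: CrealP; rewrite realV ger0_real // sqrtC_ge0 ltW.
have rD : r * r * D = 1.
  by rewrite -expr2 exprVn sqrtCK mulVf // gt_eqF.
have nrm : r * (1 + a) * (r * (1 + a))^* + r * b * (r * b)^* = 1.
  by rewrite !rmorphM /= rR -[RHS]rD /D; ring.
exists (su2 (r * (1 + a)) (r * b)), r.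
rewrite SU_valE su2_alE // su2_beE // [SU_val g]SU_valE.
apply/matrixP; apply: ord2P; apply: ord2P; rewrite !mxE //= -/a -/b ?add0r //.
  by rewrite rmorphM /= rR mulrN.
by rewrite rmorphM /= rmorphD /= rmorph1 rR.
Qed.

(* [1 + y^-1 x], rescaled into SU(2), intertwines [x] and [y]. *)
Lemma su2_conj_sq x y : (x * x = m1)%g -> (y * y = m1)%g -> (y * x <> 1)%g ->
  exists2 h, (y * h = h * x)%g & forall w, commute w (y^-1 * x)%g -> commute w h.
Proof.
move=> xx yy yx; have yV : (y^-1 = m1 * y)%g.
  by apply: (mulgI y); rewrite mulgV mulgA -su2_m1C -mulgA yy su2_m1_sq.
have [|h [r hE]] := @su2_half (y^-1 * x)%g.
  move/(congr1 (fun w : SU2 => y * w)%g); rewrite mulVKg => xE; apply: yx.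
  by rewrite xE mulgA yy su2_m1_sq.
exists h => [|w wg].
  apply: val_inj; rewrite /= hE -scalemxAl -scalemxAr mulmxDl mulmxDr mul1mx mulmx1.
  congr (_ *: _); rewrite addrC; congr (_ + _).
    by have := congr1 (@SU_val R 2) (mulVKg y x).
  rewrite -[RHS]/(SU_val (y^-1 * x * x)%g) -mulgA xx yV -su2_m1C mulgA su2_m1_sq.
  by rewrite mul1g.
apply: val_inj; rewrite /= hE -scalemxAl -scalemxAr mulmxDl mulmxDr mul1mx mulmx1.
by congr (_ *: (_ + _)); have := congr1 (@SU_val R 2) wg.
Qed.

Section ImaginaryTorusElement.
Variable u : SU2.
Hypotheses (u0 : su2_be u = 0) (u2 : su2_al u * su2_al u = -1).

(** Stated for any [u] whose first coordinate is a square root of -1, not only for [su2_i]: later a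
    power of a root of unity takes this place, and which of the two square roots it is stays
    open. *)
Lemma su2_imag_sq : (u * u = m1)%g.
Proof.
by apply: su2_eq; rewrite !su2E u0 ?su2_simpE.
Qed.

Lemma su2_imag_conj : (su2_al u)^* = - su2_al u.
Proof.
have un := su2_norm_al u0.
have z0 : su2_al u != 0.
  by apply/eqP => z0; move/eqP: un; rewrite z0 mul0r eq_sym oner_eq0.
by apply: (mulfI z0); rewrite un mulrN u2 opprK.
Qed.

Lemma su2_imag_j : (jS * u = m1 * (u * jS))%g.
Proof.
apply: su2_eq; rewrite !su2E u0 ?su2_imag_conj ?conjC0 ?conjC1; ring.
Qed.

Lemma su2_imag_noncentral : ~ pm_one_set u.
Proof.
move=> /pm_one_setE ue; have /eqP := u2.
by case: ue => ->; rewrite !su2E ?mulrNN mulr1 -addr_eq0 -mulr2n pnatr_eq0.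
Qed.

End ImaginaryTorusElement.

Lemma su2_ii : su2_al iS * su2_al iS = -1.
Proof. by rewrite su2_i_al -expr2 sqrCi. Qed.

Lemma su2_i_sq : (iS * iS = m1)%g.
Proof. exact: su2_imag_sq (su2_i_be R) su2_ii. Qed.

Lemma su2_j_sq : (jS * jS = m1)%g.
Proof.
by apply: su2_eq; rewrite !su2E ?conjC1 ?conjC0; ring.
Qed.

Lemma su2_ji : (jS * iS = m1 * (iS * jS))%g.
Proof. exact: su2_imag_j (su2_i_be R) su2_ii. Qed.

Lemma su2_m1J h : (m1 ^ h = m1)%g.
Proof. by rewrite conjgE su2_m1C mulKg. Qed.

Lemma su2_sqV x : (x * x = m1)%g -> (x^-1 = m1 * x)%g.
Proof.
by move=> xx; apply: (mulgI x); rewrite mulgV mulgA -su2_m1C -mulgA xx su2_m1_sq.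
Qed.

(** Transitivity of PU(2) = SO(3) on orthonormal 2-frames: first [x] is moved to [u], then the image
    [y1] of [y] is moved to [v] by an element of the centraliser of [u]. *)
Lemma su2_pair x y (u v : SU2) : (x * x = m1)%g -> (y * y = m1)%g ->
  (y * x = m1 * (x * y))%g -> (u * u = m1)%g -> (v * v = m1)%g ->
  (v * u = m1 * (u * v))%g -> exists h, (x ^ h = u)%g /\ (y ^ h = v)%g.
Proof.
move=> xx yy yx uu vv vu.
have conjE (w w' h : SU2) : (w * h = h * w')%g -> (w ^ h = w')%g.
  by move=> e; rewrite conjgE e mulKg.
have eqV (w w' : SU2) : (w * w = m1 -> w * w' = 1 -> w = m1 * w')%g.
  by move=> ww /(congr1 (fun z : SU2 => w * z)%g); rewrite mulgA ww mulg1 => ->.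
have [h1 h1x] : exists h, (x ^ h = u)%g.
  (* In the antipodal case [x = m1 * u] the intertwiner degenerates; [v], which anticommutes with
     [u], does the job instead. *)
  have [xu|xu] := pselect (x * u = 1)%g.
    by exists v; apply: conjE; rewrite (eqV _ _ xx xu) -mulgA -vu.
  by have [h hE _] := su2_conj_sq uu xx xu; exists h; exact: conjE.
have [y1 y1E] : exists w, w = (y ^ h1)%g by exists (y ^ h1)%g.
have y1y1 : (y1 * y1 = m1)%g by rewrite y1E -conjMg yy su2_m1J.
have y1u : (y1 * u = m1 * (u * y1))%g.
  by have := congr1 (fun w : SU2 => w ^ h1)%g yx; rewrite !conjMg su2_m1J h1x -y1E.
suff [h2 [h2u h2y]] : exists h, commute u h /\ (y1 * h = h * v)%g.
  by exists (h1 * h2)%g; rewrite !conjgM h1x -y1E; split; exact: conjE.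
have [yv|yv] := pselect (y1 * v = 1)%g.
  exists u; split; first exact: commute_refl.
  by rewrite (eqV _ _ y1y1 yv) -mulgA vu mulgA su2_m1_sq mul1g.
(* Both [y1] and [v] anticommute with [u], so [y1^-1 * v] commutes with it; hence [h] also fixes
   [u]. *)
have [h hE hC] := su2_conj_sq vv y1y1 yv; exists h; split=> //.
apply: hC; rewrite /commute su2_sqV // -!mulgA vu.
rewrite [(y1 * (m1 * _))%g]mulgA -su2_m1C -mulgA [(y1 * (u * _))%g]mulgA y1u.
by rewrite !mulgA su2_m1_sq mul1g -su2_m1C.
Qed.

Lemma su2_fix_i x : (iS ^ x = iS)%g -> su2_be x = 0.
Proof.
move=> ix; have := congr1 (@su2_be R) (mulVKg x (iS * x)%g).
rewrite -conjgE ix !su2E conjCi ?mul0r ?mulr0 ?addr0 ?add0r mulrN => /eqP.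
rewrite -subr_eq0 -opprD oppr_eq0 [_ * 'i]mulrC -mulr2n mulrn_eq0 /= mulf_eq0.
by rewrite (negPf (neq0Ci _)) => /eqP.
Qed.

Lemma su2_neg_i x : (iS ^ x = m1 * iS)%g -> su2_al x = 0.
Proof.
move=> ix; have := congr1 (@su2_al R) (mulVKg x (iS * x)%g).
rewrite -conjgE ix !su2E ?mul0r ?mulr0 ?addr0 conjC0 ?mulr0 ?subr0 mulN1r mulrN => /eqP.
rewrite -subr_eq0 -opprD oppr_eq0 [_ * 'i]mulrC -mulr2n mulrn_eq0 /= mulf_eq0.
by rewrite (negPf (neq0Ci _)) => /eqP.
Qed.
End SU2conj.

(** * SU(2) is compact and Hausdorff *)

Section SU2topology.
Variable R : realType.
Local Notation C := R[i].
Local Notation SU2 := (SU R 2).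
Local Open Scope complex_scope.

Lemma real_complex_continuous : continuous (fun x : R => x%:C : C).
Proof.
move=> x; apply/(@cvgrPdist_lt C C R _ (nbhs_filter x)) => e.
case: e => e e'; rewrite ltcE /= => /andP[/eqP -> e0].
near=> y; rewrite -rmorphB /= normc_def /= expr0n /= addr0 sqrtr_sqr ltcR.
by near: y; apply: (@near_ball R R x e e0).
Unshelve. all: by end_near. Qed.

Lemma complex_continuous (T : topologicalType) (g h : T -> R) :
  continuous g -> continuous h -> continuous (fun t => (g t)%:C + 'i * (h t)%:C : C).
Proof.
move=> gc hc t; apply: cvgD; last (apply: cvgM; first exact: cvg_cst).
  apply: (@continuous_comp _ _ _ g (fun x : R => x%:C : C)); first exact: gc.
  exact: real_complex_continuous.
apply: (@continuous_comp _ _ _ h (fun x : R => x%:C : C)); first exact: hc.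
exact: real_complex_continuous.
Qed.

Lemma su2_mx_continuous (T : topologicalType) (a b : T -> C) :
  continuous a -> continuous b -> continuous (fun t => su2_mx (a t) (b t)).
Proof.
move=> ac bc; have cJ (g : T -> C) : continuous g -> continuous (fun v => (g v)^*%R).
  move=> gc v; apply: (@continuous_comp _ _ _ g (fun z : C => z^*%R)).
    exact: gc.
  exact: conjC_continuous.
apply: mx_continuous; apply: ord2P; apply: ord2P; under eq_fun do rewrite mxE /=.
- exact: ac.
- exact: bc.
- by move=> v; apply: cvgN; apply: cJ.
- exact: cJ.
Qed.

Lemma sum_sqr_continuous (T : topologicalType) n (g : 'I_n -> T -> R) :
  (forall i, continuous (g i)) -> continuous (fun t => \sum_i g i t ^+ 2).
Proof.
move=> gc t; apply: cvg_big => [|i _]; first exact: add_continuous.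
by apply: cvgM; exact: gc.
Qed.

(** SU(2) is the continuous image of the unit sphere of $\mathbb{R}^4$, which is closed in a
    cube. *)
Lemma su2_compact : compact [set: SU2].
Proof.
apply: compact_initial.
pose f (v : 'rV[R]_4) : 'M[C]_2 :=
  su2_mx ((v 0 0)%:C + 'i * (v 0 1)%:C) ((v 0 2)%:C + 'i * (v 0 3)%:C).
pose S := [set v : 'rV[R]_4 | \sum_i v 0 i ^+ 2 = 1].
have cc i : continuous (fun v : 'rV[R]_4 => v 0 i) by exact: coord_continuous.
have nrm (p q : R) : (p%:C + 'i * q%:C) * (p%:C + 'i * q%:C)^* = (p ^+ 2 + q ^+ 2)%:C :> C.
  by apply/eqP; rewrite eq_complex /=; apply/andP; split; apply/eqP; ring.
have sum4 (v : 'rV[R]_4) :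
    \sum_i v 0 i ^+ 2 = v 0 0 ^+ 2 + v 0 1 ^+ 2 + (v 0 2 ^+ 2 + v 0 3 ^+ 2).
  rewrite !big_ord_recl big_ord0 addr0 -!addrA.
  by do !congr (_ + _); congr (v 0 _ ^+ _); exact/val_inj.
have -> : range (@SU_val R 2) = f @` S.
  rewrite eqEsubset; split => [_ [A _ <-]|_ [v Sv <-]].
    exists (\row_i [:: complex.Re (su2_al A); complex.Im (su2_al A); complex.Re (su2_be A); complex.Im (su2_be A)]`_i).
      rewrite /S /= sum4 !mxE /=; apply: (@complexI R).
      by rewrite rmorph1 -(su2_norm A) rmorphD /= -!nrm -!complexE.
    by rewrite /f !mxE /= -!complexE -SU_valE.
  have ab : ((v 0 0)%:C + 'i * (v 0 1)%:C) * ((v 0 0)%:C + 'i * (v 0 1)%:C)^*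
    + ((v 0 2)%:C + 'i * (v 0 3)%:C) * ((v 0 2)%:C + 'i * (v 0 3)%:C)^* = 1 :> C.
    by rewrite !nrm -rmorphD -sum4 Sv.
  by exists (MkSU (su2_mx_in_SU ab)).
apply: continuous_compact.
  apply: continuous_subspaceT; apply: su2_mx_continuous;
    exact: complex_continuous.
have cS : closed S.
  apply: (@closed_coincidence _ R (fun v : 'rV[R]_4 => \sum_i v 0 i ^+ 2) (fun=> 1)).
  - exact: Rhausdorff.
  - exact: (sum_sqr_continuous cc).
  - exact: cst_continuous.
apply: (subclosed_compact cS (@rV_compact R 4 (fun=> `[-1, 1]%classic) _)).
  by move=> i; exact: segment_compact.
move=> v Sv i /=; rewrite in_itv /= -ler_norml -(@expr_le1 _ 2) // real_normK ?num_real // -Sv (bigD1 i) //=.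
by rewrite lerDl sumr_ge0 // => j _; exact: sqr_ge0.
Qed.

Lemma su2_hausdorff : hausdorff_space SU2.
Proof.
apply: hausdorff_separating => A B AB.
have hC : hausdorff_space C by exact: (@norm_hausdorff C C).
have [aE|aN] := eqVneq (su2_al A) (su2_al B); last first.
  by exists C, (@su2_al R); split => //; exact: SU_coord_continuous.
have [bE|bN] := eqVneq (su2_be A) (su2_be B).
  by rewrite (su2_eq aE bE) eqxx in AB.
by exists C, (@su2_be R); split => //; exact: SU_coord_continuous.
Qed.

End SU2topology.

(** * Free groups and their nilpotent quotients *)

Section Morphisms.
Variables (G H : groupType) (f : G -> H).
Hypothesis fM : {morph f : x y / (x * y)%g}.

Lemma morph1g : f 1%g = 1%g.
Proof. by apply: (mulgI (f 1%g)); rewrite -fM !mulg1. Qed.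

Lemma morphVg x : f x^-1%g = (f x)^-1%g.
Proof. by apply: (mulgI (f x)); rewrite -fM !mulgV morph1g. Qed.

Lemma morphRg x y : f [~ x, y]%g = [~ f x, f y]%g.
Proof. by rewrite /commg /conjg !fM !morphVg. Qed.

(* [P k] contains the image of the [k]-th term of the lower central series,
   indexed from 0. *)
Lemma lcs_image (P : nat -> set H) :
  (forall k, is_subgroup (P k)) -> (forall x, P 0%N (f x)) ->
  (forall k x y, P k x -> P k.+1 [~ x, f y]%g) ->
  forall k x, lcs_set k.+1 x -> P k (f x).
Proof.
move=> Psub P0 PS; elim=> [|k IH] x; first by move=> _; exact: P0.
have [P1 PM PV] := Psub k.+1.
(* Minimality of the generated subgroup, applied to the preimage of [P k.+1]: it is a subgroup that
   contains the generating commutators. *)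
move=> /(_ [set z | P k.+1 (f z)]); apply; split.
  split=> [|y z Py Pz|y Py] /=; first by rewrite morph1g.
    by rewrite fM; exact: PM.
  by rewrite morphVg; exact: PV.
by move=> _ [a Aa [b _ <-]] /=; rewrite morphRg; apply: PS; exact: IH.
Qed.

Lemma quot_lift_pi (N : normalSubgroup G) :
  (forall x, ns_set N x -> f x = 1%g) ->
  forall x, f (repr (\pi_(quotientGroup N) x)) = f x.
Proof.
move=> fN x; apply: (mulgI (f x)^-1)%g.
by rewrite mulVg -morphVg -fM; apply: fN; exact: repr_coset.
Qed.

Lemma quot_lift_morph (N : normalSubgroup G) :
  (forall x, ns_set N x -> f x = 1%g) ->
  {morph (fun a : quotientGroup N => f (repr a)) : x y / (x * y)%g}.
Proof.
by move=> fN a b; rewrite [(a * b)%g]/(quot_mul _ _) /quot_mul quot_lift_pi.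
Qed.

End Morphisms.

Lemma piM_quot (G : groupType) (N : normalSubgroup G) :
  {morph (fun x : G => \pi_(quotientGroup N) x) : x y / (x * y)%g}.
Proof. by move=> x y; rewrite -pi_quot_mul. Qed.

Lemma lcs_commg (G : groupType) k (x y : G) :
  lcs_set k.+1 x -> lcs_set k.+2 [~ x, y]%g.
Proof. by move=> lx B [_]; apply; exists x => //; exists y. Qed.

Section FreeLift.
Variables (n : nat) (G : groupType).
Implicit Types (g : 'I_n -> G) (u v : word n).

Definition letter_eval g (l : 'I_n * bool) : G :=
  if l.2 then g l.1 else (g l.1)^-1%g.

Definition word_eval g u : G := (\prod_(l <- u) letter_eval g l)%g.

Definition free_lift g (x : freeGroup n) : G := word_eval g (repr x).

Lemma word_eval_cat g u v : word_eval g (u ++ v) = (word_eval g u * word_eval g v)%g.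
Proof. exact: big_cat. Qed.

Lemma word_eval_cong g u v : word_cong u v -> word_eval g u = word_eval g v.
Proof.
elim=> {u v} [u l v|//|u v _ ->//|u v w _ -> _ ->//].
rewrite !word_eval_cat /word_eval !big_cons; congr (_ * _)%g.
by case: l => i []; rewrite /letter_eval /= ?mulVKg ?mulKg.
Qed.

Lemma free_lift_pi g u : free_lift g (\pi_(freeGroup n) u) = word_eval g u.
Proof. exact/esym/word_eval_cong/repr_word. Qed.

Lemma free_liftM g : {morph free_lift g : x y / (x * y)%g}.
Proof.
by move=> x y; rewrite [(x * y)%g]/(free_mul _ _) /free_mul free_lift_pi word_eval_cat.
Qed.

Lemma free_lift_gen g i : free_lift g (free_gen i) = g i.
Proof. by rewrite free_lift_pi /word_eval big_seq1. Qed.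

Lemma free_piM u v :
  \pi_(freeGroup n) (u ++ v) = (\pi_(freeGroup n) u * \pi_(freeGroup n) v)%g.
Proof. by rewrite -pi_free_mul. Qed.

Lemma free_genV i : (free_gen i)^-1%g = \pi_(freeGroup n) [:: (i, false)].
Proof. exact: (pi_free_inv [:: (i, true)]). Qed.

Lemma free_liftE (f : freeGroup n -> G) : {morph f : x y / (x * y)%g} ->
  f =1 free_lift (f \o @free_gen n).
Proof.
move=> fM x; rewrite -[x]reprF free_lift_pi; elim: (repr x) => [|l u IH].
  by rewrite /word_eval big_nil; exact: (morph1g fM).
rewrite -cat1s word_eval_cat -IH free_piM fM.
congr (_ * _)%g; rewrite /word_eval big_seq1 /letter_eval; case: l => i [] //=.
by rewrite -(morphVg fM) free_genV.
Qed.

End FreeLift.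

Section NilpotentQuotient.
Variables (n q : nat) (G : groupType).
Local Notation Gamma := (quotientGroup (lcs (freeGroup n) q)).

Definition nil_gen (i : 'I_n) : Gamma := \pi_Gamma (free_gen i).

Lemma nil_hom_ext (f g : Gamma -> G) :
  {morph f : x y / (x * y)%g} -> {morph g : x y / (x * y)%g} ->
  (forall i, f (nil_gen i) = g (nil_gen i)) -> f =1 g.
Proof.
move=> fM gM fg x; rewrite -[x]reprQ.
have piM := @piM_quot _ (lcs (freeGroup n) q).
have f1 : {morph f \o \pi_Gamma : x y / (x * y)%g} by move=> u v; rewrite /= piM fM.
have g1 : {morph g \o \pi_Gamma : x y / (x * y)%g} by move=> u v; rewrite /= piM gM.
rewrite [LHS](free_liftE f1) [RHS](free_liftE g1).
by congr (free_lift _ _); apply: funext => i; exact: fg.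
Qed.

End NilpotentQuotient.

Section IntegerPowers.
Variable G : groupType.
Implicit Types (g h : G) (z w : int).

Definition zpow g z : G :=
  match z with Posz k => (g ^+ k)%g | Negz k => (g ^- k.+1)%g end.

(** With every integer written as a difference of naturals, additivity of [zpow] needs no case
    distinction on signs. *)
Lemma zpow_subn g (a b : nat) : zpow g (a%:Z - b%:Z) = (g ^+ a * g ^- b)%g.
Proof.
have [ba|/ltnW ab] := leqP b a.
  by rewrite subzn //; exact: expgnFr.
rewrite -opprB subzn //; case E : (b - a)%N => [|k].
  have -> : b = a by apply/eqP; rewrite eqn_leq ab -subn_eq0 E.
  by rewrite oppr0 mulgV.
have -> : b = (a + k.+1)%N by rewrite -E subnKC.
by rewrite -NegzE /= addnC expgnDr invgM mulgA mulgV mul1g.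
Qed.

Lemma zpowD g z w : zpow g (z + w) = (zpow g z * zpow g w)%g.
Proof.
have diff t : exists a b : nat, t = a%:Z - b%:Z.
  case: t => k; first by exists k, 0%N; rewrite subr0.
  by exists 0%N, k.+1; rewrite NegzE sub0r.
have [a [b ->]] := diff z; have [c [d ->]] := diff w.
rewrite addrACA -opprD -!PoszD !zpow_subn !expgnDr invgM.
have gc : commute (g ^- b)%g (g ^+ c * g ^- d)%g.
  by apply: commuteM; do ?apply: commuteV; apply/commute_sym; do ?apply: commuteV;
    apply: commuteX2; exact: commute_refl.
by rewrite -!mulgA; congr (_ * _)%g; rewrite gc !mulgA.
Qed.

Lemma commute_zpow g h z w : commute g h -> commute (zpow g z) (zpow h w).
Proof.
have cz x y t : commute x y -> commute x (zpow y t).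
  move=> xy; case: t => k; first exact: commuteX.
  exact/commuteV/commuteX.
by move=> gh; apply/cz/commute_sym/cz/commute_sym.
Qed.

End IntegerPowers.

Section Abelianisation.
Variables (n : nat) (G : groupType).

Definition ab_gen (i : 'I_n) : freeAbelian n := delta_mx 0 i : 'rV[int]_n.

Definition zpow_prod (g : 'I_n -> G) (v : freeAbelian n) : G :=
  (\prod_(i < n) zpow (g i) ((v : 'rV[int]_n) 0 i))%g.

Lemma zpow_prodM g : (forall i j, commute (g i) (g j)) ->
  {morph zpow_prod g : u v / (u * v)%g}.
Proof.
move=> gC u v; rewrite /zpow_prod -prodgM_commute => [|i j _ _].
  by apply: eq_bigr => i _; rewrite -zpowD; congr (zpow _ _); rewrite mxE.
exact: commute_zpow.
Qed.

Lemma zpow_prod_gen g i : zpow_prod g (ab_gen i) = g i.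
Proof.
rewrite /zpow_prod (eq_bigr (fun j => if j == i then g i else 1%g)).
  by rewrite -big_mkcond big_pred1_eq.
by move=> j _; rewrite mxE eqxx /=; case: eqP => [->|].
Qed.

Lemma zpow_prodE (f : freeAbelian n -> G) : {morph f : u v / (u * v)%g} ->
  f =1 zpow_prod (f \o ab_gen).
Proof.
move=> fM v; have fX w k : f (w ^+ k)%g = (f w ^+ k)%g.
  by elim: k => [|k IH]; rewrite ?expg0 ?(morph1g fM) // !expgS fM IH.
have vE : v = (\prod_(i < n) zpow (ab_gen i) ((v : 'rV[int]_n) 0 i))%g.
  rewrite [LHS](row_sum_delta (v : 'rV[int]_n)).
  apply: (eq_bigr (fun i : 'I_n => zpow (ab_gen i) ((v : 'rV[int]_n) 0 i) : 'rV[int]_n)) => i _.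
  have nE (k : nat) : (ab_gen i ^+ k)%g = k%:Z *: (ab_gen i : 'rV[int]_n).
    elim: k => [|k IH]; first by rewrite expg0 scale0r.
    by rewrite expgS IH -[k.+1]add1n PoszD scalerDl scale1r.
  by case: (v 0 i) => k; rewrite /zpow nE // NegzE scaleNr.
rewrite [in LHS]vE (big_morph f fM (morph1g fM)); apply: eq_bigr => i _.
by case: (v 0 i) => k /=; rewrite ?(morphVg fM) fX.
Qed.

End Abelianisation.

Section AbelianHom.
Variables (n q : nat) (G : topologicalGroupType).
Hypothesis q0 : (0 < q)%N.
Local Notation Gamma := (quotientGroup (lcs (freeGroup n) q.+1)).

Definition ab_map (x : Gamma) : freeAbelian n := free_lift (@ab_gen n) (repr x).

(** In an abelian target all terms from the second on are trivial, and [q.+1] is at least 2. *)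
Lemma ab_lcs (x : freeGroup n) :
  ns_set (lcs (freeGroup n) q.+1) x -> free_lift (@ab_gen n) x = 1%g.
Proof.
case: q q0 => // k _.
apply: (@lcs_image _ _ _ (@free_liftM n _ (@ab_gen n))
  (fun k => if k is k'.+1 then [set 1%g] else [set: freeAbelian n])) => //.
  case=> [|j]; split=> //= u v; first by move=> -> ->; rewrite mulg1.
  by rewrite v invg1.
by move=> j u v _; apply/eqP/commgP; exact: (@addrC 'rV[int]_n).
Qed.

Lemma ab_mapM : {morph ab_map : x y / (x * y)%g}.
Proof. exact: (quot_lift_morph (@free_liftM n _ (@ab_gen n)) ab_lcs). Qed.

Lemma ab_map_gen i : ab_map (nil_gen q.+1 i) = ab_gen i.
Proof.
by rewrite /ab_map (quot_lift_pi (@free_liftM n _ (@ab_gen n)) ab_lcs) free_lift_gen.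
Qed.

Lemma ab_pull_morph (f : HomSpace (freeAbelian n) G) :
  {morph (\val f : freeAbelian n -> G) \o ab_map : x y / (x * y)%g}.
Proof. by move=> x y /=; rewrite ab_mapM; exact: (set_valP f). Qed.

Definition ab_pull (f : HomSpace (freeAbelian n) G) : HomSpace Gamma G :=
  exist _ ((\val f : freeAbelian n -> G) \o ab_map) (mem_set (ab_pull_morph f)).

Lemma ab_pull_continuous : continuous ab_pull.
Proof.
by apply: continuous_to_HomSpace => x; exact: HomSpace_eval_continuous.
Qed.

Lemma ab_pull_inj : injective ab_pull.
Proof.
move=> f g fg; apply: HomSpace_eq => v.
rewrite (zpow_prodE (set_valP f)) (zpow_prodE (set_valP g)).
congr (zpow_prod _ _); apply: funext => i /=.
have := congr1 (fun h : HomSpace Gamma G => (\val h : Gamma -> G) (nil_gen q.+1 i)) fg.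
by rewrite /= ab_map_gen.
Qed.

Lemma ab_pull_surj (f : HomSpace Gamma G) :
  (forall i j, commute ((\val f : Gamma -> G) (nil_gen q.+1 i))
                       ((\val f : Gamma -> G) (nil_gen q.+1 j))) ->
  exists f', ab_pull f' = f.
Proof.
move=> fC; pose h := zpow_prod (fun i => (\val f : Gamma -> G) (nil_gen q.+1 i)).
have hM : {morph h : u v / (u * v)%g} by exact: zpow_prodM.
exists (exist _ (h : {ptws _ -> _}) (mem_set hM)); apply: HomSpace_eq.
apply: (nil_hom_ext (ab_pull_morph _) (set_valP f)) => i /=.
by rewrite ab_map_gen /h zpow_prod_gen.
Qed.

Lemma ab_pull_commute (f : HomSpace (freeAbelian n) G) x y :
  commute ((\val (ab_pull f) : Gamma -> G) x) ((\val (ab_pull f) : Gamma -> G) y).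
Proof.
rewrite /commute /= -!(set_valP f); congr (\val f _); exact: (@addrC 'rV[int]_n).
Qed.

End AbelianHom.

(** * Counting words by their first letters *)

Section Counting.
Variable L : finType.
Implicit Types (p r : pred L) (P : seq L -> bool) (s : seq L).

(** A word without any letter in [p] is rejected, so that a normal form also asserts the existence
    of the letters that witness noncommutation. *)
Fixpoint first_is p r s :=
  if s is x :: s' then if p x then r x else first_is p r s' else false.

Definition word_count P n : nat := (\sum_(t : n.-tuple L) P t)%N.

Lemma word_count0 P : word_count P 0 = P [::].
Proof.
rewrite /word_count (big_pred1 [tuple]) // => t.
by apply/esym/eqP; exact: tuple0.
Qed.

Lemma word_countS P n :
  word_count P n.+1 = (\sum_(x : L) word_count (fun s => P (x :: s)) n)%N.
Proof.
rewrite /word_count pair_bigA /=.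
rewrite (reindex (fun u : L * n.-tuple L => [tuple of u.1 :: u.2])) //=.
exists (fun t => (thead t, [tuple of behead t])) => [[x t] _ | t _] /=.
  by rewrite theadE; congr (_, _); exact/val_inj.
by rewrite [t in RHS]tuple_eta; exact/val_inj.
Qed.

Lemma word_count_false n : word_count (fun=> false) n = 0%N.
Proof. by rewrite /word_count big1. Qed.

Section Filtered.
Variable r : pred L.
Variables p1 w1 p2 w2 : pred L.

Definition count_all := word_count (all r).
Definition count_first p w := word_count (fun s => all r s && first_is p w s).
Definition count_first2 :=
  word_count (fun s => [&& all r s, first_is p1 w1 s & first_is p2 w2 s]).

Lemma word_count_and (b : bool) P n :
  word_count (fun s => b && P s) n = (b * word_count P n)%N.
Proof. by case: b; rewrite ?mul1n ?mul0n ?word_count_false. Qed.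

Lemma sum_pred_mul p (c : nat) : (\sum_x p x * c = #|p| * c)%N.
Proof.
rewrite -big_distrl /= -sum1_card [in RHS]big_mkcond; congr (_ * _)%N.
Qed.

Lemma count_allE n : count_all n = (#|r| ^ n)%N.
Proof.
elim: n => [|n IH]; first by rewrite /count_all word_count0.
rewrite /count_all word_countS expnS -IH -sum_pred_mul.
by apply: eq_bigr => x _; rewrite -word_count_and.
Qed.

(** The first letter either leaves the condition pending or settles it, and after that only [r]
    restricts the word. *)
Lemma count_firstS p w n : count_first p w n.+1 =
  (#|[pred x | r x && ~~ p x]| * count_first p w n
   + #|[pred x | [&& r x, p x & w x]]| * count_all n)%N.
Proof.
rewrite /count_first word_countS -!sum_pred_mul -big_split /=.
apply: eq_bigr => x _; rewrite -!word_count_and.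
rewrite -big_split; apply: eq_bigr => t _ /=.
by move: (r x) (p x) (w x) (all r t) (first_is p w t) => [] [] [] [] [].
Qed.

(** An automaton with four states: the first letter leaves both conditions pending, settles the
    first, settles the second, or settles both. *)
Lemma count_first2S n : count_first2 n.+1 =
  (#|[pred x | [&& r x, ~~ p1 x & ~~ p2 x]]| * count_first2 n
   + #|[pred x | [&& r x, p1 x, w1 x & ~~ p2 x]]| * count_first p2 w2 n
   + #|[pred x | [&& r x, ~~ p1 x, p2 x & w2 x]]| * count_first p1 w1 n
   + #|[pred x | [&& r x, p1 x, w1 x, p2 x & w2 x]]| * count_all n)%N.
Proof.
rewrite /count_first2 word_countS -!sum_pred_mul -!big_split /=.
apply: eq_bigr => x _; rewrite -!word_count_and.
rewrite -!big_split; apply: eq_bigr => t _ /=.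
move: (r x) (p1 x) (w1 x) (p2 x) (w2 x) (all r t).
by move: (first_is p1 w1 t) (first_is p2 w2 t) => [] [] [] [] [] [] [] [].
Qed.

(** Solution of c(n+1) = s c(n) + v a^n with c(0) = 0, for distinct roots [a] and [s]. *)
Lemma count_first_closed p w n (s v a : rat) :
  #|[pred x | r x && ~~ p x]|%:R = s -> #|[pred x | [&& r x, p x & w x]]|%:R = v ->
  #|r|%:R = a -> a != s ->
  (count_first p w n)%:R = v * (a ^+ n - s ^+ n) / (a - s).
Proof.
move=> sE vE aE as0; have {}as0 : a - s != 0 by rewrite subr_eq0.
elim: n => [|n IH]; first by rewrite /count_first word_count0 !expr0 subrr mulr0 mul0r.
rewrite count_firstS natrD !natrM IH sE vE count_allE natrX aE !exprS.
by field.
Qed.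

End Filtered.
End Counting.

(** * The alphabet of the generalised quaternion group and the number of normal forms *)

Section Letters.
Variable m : nat.
Hypothesis m0 : (0 < m)%N.

Definition letter := ('I_(4 * m) * bool)%type.
Implicit Types (l : letter).

(* With [zeta] a primitive [4 * m]-th root of unity, [half_letter] says that
   [zeta ^ a] is real and [quarter_letter] that it is a fourth root of unity. *)
Definition half_letter l := (l.1 == 0 :> nat) || (l.1 == 2 * m :> nat)%N.
Definition upper_letter l := (0 < l.1 < 2 * m)%N.
Definition quarter_letter l := (m %| l.1)%N.
Definition j_letter l := (l.1 == 0 :> nat) && l.2.
Definition i_letter l := (l.1 == m :> nat) && ~~ l.2.
Definition noncentral_letter l := l.2 || ~~ half_letter l.
Definition nonhalf_letter l := ~~ half_letter l.
Definition refl_letter l := l.2.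

(* Normal forms of noncommuting tuples up to conjugation.  A tuple not contained in
   a group of order 8 determines its maximal torus, so only the angle and the
   orientation of the torus have to be fixed.  In [Q_8] there are three candidates
   for the torus, so the first two independent directions are fixed instead. *)
Definition accepted (s : seq letter) :=
  if all quarter_letter s
  then first_is noncentral_letter j_letter s && first_is nonhalf_letter i_letter s
  else first_is refl_letter j_letter s && first_is nonhalf_letter upper_letter s.

Lemma card_letter (F : nat -> bool -> bool) (G : pred letter) :
  (forall l, G l = F l.1 l.2) ->
  #|G| = (\sum_(0 <= a < 4 * m) (F a true + F a false))%N.
Proof.
move=> GF; rewrite big_mkord -sum1_card big_mkcond /=.
pose f (a : 'I_(4 * m)) b := (if (a, b) \in G then 1 else 0)%N.
rewrite (eq_bigr (fun p => f p.1 p.2)) => [|[] //].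
rewrite -(pair_bigA _ f) /f /=.
apply: eq_bigr => a _; rewrite big_bool /= !unfold_in !GF /=.
by case: (F a true); case: (F a false).
Qed.

Lemma sum_interval (N x y : nat) : (y <= N)%N ->
  (\sum_(0 <= a < N) (x <= a < y) = y - x)%N.
Proof.
move=> yN; elim: N y yN => [|N IH] y; first by rewrite leqn0 => /eqP->; rewrite big_nil.
rewrite big_nat_recr //= leq_eqVlt => /predU1P[->|yN].
  rewrite (eq_big_nat _ _ (F2 := fun a => ((x <= a < N) : nat))) => [|a /andP[_ aN]].
    by rewrite IH //; lia.
  by rewrite aN (ltnW aN : (a < N.+1)%N).
by rewrite IH //; lia.
Qed.

Lemma sum_pred1_nat (N x : nat) : (x < N)%N -> (\sum_(0 <= a < N) (a == x) = 1)%N.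
Proof.
move=> xN; rewrite -[RHS](subSnn x) -(sum_interval x xN).
by apply: eq_bigr => a _; congr nat_of_bool; lia.
Qed.

Lemma sum_multiples (F : nat -> nat) k :
  (\sum_(0 <= a < k * m) (m %| a) * F a = \sum_(0 <= j < k) F (j * m))%N.
Proof.
elim: k => [|k IH]; first by rewrite !big_nil.
rewrite [RHS]big_nat_recr //= -IH (@big_cat_nat _ _ _ (k * m)) //=; last by lia.
congr addn; rewrite big_ltn; last by lia.
rewrite dvdn_mull // mul1n big_nat big1 ?addn0 // => a /andP[ka ak].
rewrite (_ : (m %| a)%N = false) //; apply/negP => /dvdnP[j aE].
by move: ka ak; rewrite aE !ltn_pmul2r //; lia.
Qed.

(** Only the angles [0], [m], [2 * m], [3 * m] survive, so a cardinal that depends on [m] becomes a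
    sum over four values that can be computed. *)
Lemma card_quarter (F : nat -> bool -> bool) (G : pred letter) :
  (forall l k, l.1 = (k * m)%N :> nat -> G l = F k l.2) ->
  #|[pred l | quarter_letter l && G l]|
    = (\sum_(0 <= k < 4) (F k true + F k false))%N.
Proof.
move=> GF.
rewrite (card_letter (F := fun a b => (m %| a)%N && F (a %/ m)%N b)) => [|l /=].
  transitivity (\sum_(0 <= a < 4 * m) (m %| a) * (F (a %/ m) true + F (a %/ m) false))%N.
    by apply: eq_bigr => a _; case: (m %| a)%N; rewrite ?mul1n ?mul0n.
  rewrite (sum_multiples (fun a => F (a %/ m) true + F (a %/ m) false)%N).
  by apply: eq_bigr => k _; rewrite mulnK.
rewrite /quarter_letter; case: (boolP (m %| l.1)%N) => //= /dvdnP[k lk].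
by rewrite (GF _ _ lk) lk mulnK.
Qed.

Section Quarter.
Variables (l : letter) (k : nat).
Hypothesis lk : l.1 = (k * m)%N :> nat.

Lemma quarter_half : half_letter l = (k == 0) || (k == 2).
Proof. by rewrite /half_letter lk muln_eq0 eqn_pmul2r // [m == 0]eqn0Ngt m0 orbF. Qed.

Lemma quarter_upper : upper_letter l = (k == 1).
Proof. by rewrite /upper_letter lk muln_gt0 m0 andbT ltn_pmul2r //; lia. Qed.

Lemma quarter_j : j_letter l = (k == 0) && l.2.
Proof. by rewrite /j_letter lk muln_eq0 [m == 0]eqn0Ngt m0 orbF. Qed.

Lemma quarter_i : i_letter l = (k == 1) && ~~ l.2.
Proof. by rewrite /i_letter lk -{2}[m]mul1n eqn_pmul2r. Qed.

End Quarter.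

(** The second rule is counted on all words, its share on quarter words is removed, and the first
    rule is counted there. The additive form avoids truncated subtraction. *)
Lemma word_count_split n :
  (word_count accepted n
   + count_first2 quarter_letter refl_letter j_letter nonhalf_letter upper_letter n
   = count_first2 quarter_letter noncentral_letter j_letter nonhalf_letter i_letter n
   + count_first2 predT refl_letter j_letter nonhalf_letter upper_letter n)%N.
Proof.
rewrite /count_first2 /word_count -!big_split; apply: eq_bigr => t _ /=.
rewrite /accepted all_predT; case: (all quarter_letter t) => //=.
by rewrite addn0 add0n.
Qed.

Local Notation M := (m%:R : rat).

Lemma M_neq0 : M != 0. Proof. by rewrite pnatr_eq0 -lt0n. Qed.

Lemma sum4 (f : nat -> nat) : (\sum_(0 <= k < 4) f k = f 0 + f 1 + f 2 + f 3)%N.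
Proof. by rewrite !big_nat_recr //= big_nil add0n. Qed.

Definition quarterE l k (lk : l.1 = (k * m)%N :> nat) :=
  (quarter_half lk, quarter_upper lk, quarter_j lk, quarter_i lk).

Ltac card_q F :=
  rewrite (@card_quarter F);
  [ by rewrite sum4
  | let H := fresh in intros ? ? H;
    by rewrite /= /noncentral_letter /nonhalf_letter /refl_letter ?(quarterE H) ].

(** The quarter letters are the eight elements of Q_8, and the numerator counts its noncommuting
    tuples. *)
Lemma count_first2_quarter_nc n :
  (count_first2 quarter_letter noncentral_letter j_letter nonhalf_letter i_letter n)%:R
  = (8 ^+ n - 3 * 4 ^+ n + 2 * 2 ^+ n) / 24 :> rat.
Proof.
have c1 : #|quarter_letter| = 8%N.
  rewrite (@eq_card _ _ [pred l | quarter_letter l && xpredT l]); last first.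
    by move=> l; rewrite !unfold_in andbT.
  by card_q (fun (_ : nat) (_ : bool) => true).
have c2 : #|[pred l | quarter_letter l && ~~ nonhalf_letter l]| = 4%N.
  by card_q (fun (k : nat) (_ : bool) => ~~ ~~ ((k == 0) || (k == 2))).
have c3 : #|[pred l | [&& quarter_letter l, nonhalf_letter l & i_letter l]]| = 1%N.
  by card_q (fun (k : nat) (b : bool) => ~~ ((k == 0) || (k == 2)) && ((k == 1) && ~~ b)).
have c4 : #|[pred l | [&& quarter_letter l, ~~ noncentral_letter l
                        & ~~ nonhalf_letter l]]| = 2%N.
  by card_q (fun (k : nat) (b : bool) => ~~ (b || ~~ ((k == 0) || (k == 2)))
                        && ~~ ~~ ((k == 0) || (k == 2))).
have c5 : #|[pred l | [&& quarter_letter l, noncentral_letter l, j_letter l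
                        & ~~ nonhalf_letter l]]| = 1%N.
  by card_q (fun (k : nat) (b : bool) => [&& (b || ~~ ((k == 0) || (k == 2))), (k == 0) && b
                        & ~~ ~~ ((k == 0) || (k == 2))]).
have c6 : #|[pred l | [&& quarter_letter l, ~~ noncentral_letter l, nonhalf_letter l
                        & i_letter l]]| = 0%N.
  by card_q (fun (k : nat) (b : bool) => [&& ~~ (b || ~~ ((k == 0) || (k == 2))),
                            ~~ ((k == 0) || (k == 2)) & (k == 1) && ~~ b]).
have c7 : #|[pred l | [&& quarter_letter l, noncentral_letter l, j_letter l,
                          nonhalf_letter l & i_letter l]]| = 0%N.
  by card_q (fun (k : nat) (b : bool) => [&& (b || ~~ ((k == 0) || (k == 2))), (k == 0) && b,
                        ~~ ((k == 0) || (k == 2)) & (k == 1) && ~~ b]).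
elim: n => [|n IH].
  by rewrite /count_first2 word_count0 /= !expr0 mulr0n; field.
(* A nonhalf letter is noncentral and [j] is half, so the condition on [j] is always settled first:
   the last two transitions vanish. *)
rewrite count_first2S c4 c5 c6 c7 !mul0n !addn0 mul1n natrD natrM IH.
rewrite (@count_first_closed _ _ _ _ n 4 1 8) ?c1 ?c2 ?c3 // !exprS.
by field.
Qed.

(** Here [r] stands for a group of order [2 * K] with cyclic part of order [K]; it is used for
    [K = 4] and for [K = 4 * m]. *)
Lemma count_first2_refl (r : pred letter) (K : rat) n : K != 0 -> K != 2 ->
  #|r|%:R = 2 * K ->
  #|[pred l | r l && ~~ refl_letter l]|%:R = K ->
  #|[pred l | [&& r l, refl_letter l & j_letter l]]| = 1%N ->
  #|[pred l | r l && ~~ nonhalf_letter l]| = 4%N ->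
  #|[pred l | [&& r l, nonhalf_letter l & upper_letter l]]|%:R = K - 2 ->
  #|[pred l | [&& r l, ~~ refl_letter l & ~~ nonhalf_letter l]]| = 2%N ->
  #|[pred l | [&& r l, refl_letter l, j_letter l & ~~ nonhalf_letter l]]| = 1%N ->
  #|[pred l | [&& r l, ~~ refl_letter l, nonhalf_letter l & upper_letter l]]|%:R
    = K / 2 - 1 ->
  #|[pred l | [&& r l, refl_letter l, j_letter l, nonhalf_letter l
                & upper_letter l]]| = 0%N ->
  (count_first2 r refl_letter j_letter nonhalf_letter upper_letter n)%:R
  = (2 ^+ n - 1) * (K ^+ n / K - 2 ^+ n / 2) / 2.
Proof.
move=> K0 K2 c1 c2 c3 c4 c5 c6 c7 c8 c9.
elim: n => [|n IH].
  by rewrite /count_first2 word_count0 /= !expr0 mulr0n; field.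
rewrite count_first2S c6 c7 c9 !mul0n !addn0 mul1n !natrD !natrM IH c8.
(* The roots [2 * K] and [4] of the recursion for the second condition must differ; this is where
   [K != 2] enters. *)
have K4 : 2 * K != 4.
  by apply: contra K2 => /eqP e; apply/eqP; lra.
have K4' : 2 * K - 4 != 0 by rewrite subr_eq0.
rewrite (@count_first_closed _ r refl_letter j_letter n K 1 (2 * K)) ?c3 //; last first.
  by apply: contra K0 => /eqP e; apply/eqP; lra.
rewrite (@count_first_closed _ r nonhalf_letter upper_letter n 4 (K - 2) (2 * K)) ?c4 //.
rewrite !exprS !exprMn (_ : 4 = 2 * 2) ?exprMn; last by [].
by field; rewrite K0.
Qed.

(** This is three times the value of [count_first2_quarter_nc]: the second rule would list each
    class in Q_8 once for each of its three tori. *)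
Lemma count_first2_quarter_refl n :
  (count_first2 quarter_letter refl_letter j_letter nonhalf_letter upper_letter n)%:R
  = (2 ^+ n - 1) * (4 ^+ n / 4 - 2 ^+ n / 2) / 2 :> rat.
Proof.
apply: count_first2_refl => //.
- rewrite (@eq_card _ _ [pred l | quarter_letter l && xpredT l]); last first.
    by move=> l; rewrite !unfold_in andbT.
  suff -> : #|[pred l | quarter_letter l && xpredT l]| = 8%N by [].
  by card_q (fun (_ : nat) (_ : bool) => true).
- suff -> : #|[pred l | quarter_letter l && ~~ refl_letter l]| = 4%N by [].
  by card_q (fun (k : nat) (b : bool) => ~~ b).
- by card_q (fun (k : nat) (b : bool) => b && ((k == 0) && b)).
- by card_q (fun (k : nat) (b : bool) => ~~ ~~ ((k == 0) || (k == 2))).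
- suff -> : #|[pred l | [&& quarter_letter l, nonhalf_letter l & upper_letter l]]|
      = 2%N by [].
  by card_q (fun (k : nat) (b : bool) => ~~ ((k == 0) || (k == 2)) && (k == 1)).
- by card_q (fun (k : nat) (b : bool) => ~~ b && ~~ ~~ ((k == 0) || (k == 2))).
- by card_q (fun (k : nat) (b : bool) =>
    [&& b, (k == 0) && b & ~~ ~~ ((k == 0) || (k == 2))]).
- suff -> : #|[pred l | [&& quarter_letter l, ~~ refl_letter l, nonhalf_letter l
                          & upper_letter l]]| = 1%N by [].
  by card_q (fun (k : nat) (b : bool) =>
    [&& ~~ b, ~~ ((k == 0) || (k == 2)) & k == 1]).
- by card_q (fun (k : nat) (b : bool) =>
    [&& b, (k == 0) && b, ~~ ((k == 0) || (k == 2)) & k == 1]).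
Qed.

Lemma sum_half : (\sum_(0 <= a < 4 * m) ((a == 0) || (a == 2 * m)%N) = 2)%N.
Proof.
transitivity (\sum_(0 <= a < 4 * m) ((a == 0) + (a == 2 * m)%N))%N.
  by apply: eq_bigr => a _; lia.
by rewrite big_split /= !sum_pred1_nat //; lia.
Qed.

Lemma sum_upper : (\sum_(0 <= a < 4 * m) (0 < a < 2 * m)%N = (2 * m).-1)%N.
Proof. by rewrite sum_interval ?subn1 // leq_mul2r orbT. Qed.

Ltac card_T F :=
  rewrite (@card_letter F); last first;
  [ let x := fresh in intros x;
    by rewrite /= /refl_letter /nonhalf_letter /half_letter /j_letter | ].

Lemma count_first2_all_refl n :
  (count_first2 predT refl_letter j_letter nonhalf_letter upper_letter n)%:R
  = (2 ^+ n - 1) * ((4 * M) ^+ n / (4 * M) - 2 ^+ n / 2) / 2 :> rat.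
Proof.
have mM : 1 <= M by rewrite ler1n.
have predM : (2 * m).-1%:R = 2 * M - 1 :> rat.
  by rewrite -subn1 natrB ?natrM //; lia.
apply: count_first2_refl => //.
- by apply/eqP => e; lra.
- by apply/eqP => e; lra.
- by rewrite cardT -cardE card_prod card_ord card_bool !natrM; ring.
- card_T (fun (a : nat) (b : bool) => ~~ b).
  by rewrite sum_nat_const_nat subn0 !natrM mulr1.
- card_T (fun (a : nat) (b : bool) => b && ((a == 0) && b)).
  rewrite -[RHS](@sum_pred1_nat (4 * m) 0) ?muln_gt0 //.
  by apply: eq_bigr => a _; rewrite andbT addn0.
- card_T (fun (a : nat) (b : bool) => ~~ ~~ ((a == 0) || (a == 2 * m)%N)).
  transitivity (\sum_(0 <= a < 4 * m) ((a == 0) || (a == 2 * m)) * 2)%N.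
    by apply: eq_bigr => a _; rewrite negbK muln2 addnn.
  by rewrite -big_distrl /= sum_half.
- card_T (fun (a : nat) (b : bool) =>
    ~~ ((a == 0) || (a == 2 * m)%N) && (0 < a < 2 * m)%N).
  transitivity (((2 * m).-1 + (2 * m).-1)%:R : rat); last by rewrite natrD predM; ring.
  congr (_%:R); rewrite -sum_upper -big_split; apply: eq_bigr => a _ /=; lia.
- card_T (fun (a : nat) (b : bool) => ~~ b && ~~ ~~ ((a == 0) || (a == 2 * m)%N)).
  by rewrite -[RHS]sum_half; apply: eq_bigr => a _; rewrite add0n negbK.
- card_T (fun (a : nat) (b : bool) =>
    [&& b, (a == 0) && b & ~~ ~~ ((a == 0) || (a == 2 * m)%N)]).
  rewrite -[RHS](@sum_pred1_nat (4 * m) 0) ?muln_gt0 //.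
  by apply: eq_bigr => a _; lia.
- card_T (fun (a : nat) (b : bool) =>
    [&& ~~ b, ~~ ((a == 0) || (a == 2 * m)%N) & (0 < a < 2 * m)%N]).
  transitivity ((2 * m).-1%:R : rat); last by rewrite predM; field.
  by congr (_%:R); rewrite -sum_upper; apply: eq_bigr => a _ /=; lia.
- card_T (fun (a : nat) (b : bool) =>
    [&& b, (a == 0) && b, ~~ ((a == 0) || (a == 2 * m)%N) & (0 < a < 2 * m)%N]).
  by rewrite big1 // => a _; lia.
Qed.

Lemma word_count_accepted n :
  (word_count accepted n)%:R =
  (8 ^+ n - 3 * 4 ^+ n + 2 * 2 ^+ n) / 24
  + (2 ^+ n - 1) * ((4 * M) ^+ n / (4 * M) - 4 ^+ n / 4) / 2 :> rat.
Proof.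
have /(congr1 (fun k => k%:R : rat)) := word_count_split n.
rewrite !natrD count_first2_quarter_refl count_first2_quarter_nc count_first2_all_refl.
by move=> /(canRL (addrK _)) ->; field; rewrite M_neq0.
Qed.

End Letters.

(** * Conjugacy classes of noncommuting tuples *)

Lemma first_isE (L : finType) (p r : pred L) (x0 : L) s :
  first_is p r s = has p s && r (nth x0 s (find p s)).
Proof. by elim: s => [|x s IH] //=; case: (p x). Qed.

Lemma first_isP (L : finType) (p r : pred L) n (t : n.-tuple L) :
  reflect (exists i, [/\ p (tnth t i), r (tnth t i) &
    forall j : 'I_n, (j < i)%N -> ~~ p (tnth t j)]) (first_is p r t).
Proof.
case: n t => [|n] t.
  by rewrite tuple0 /=; constructor => -[[]].
pose x0 := tnth t ord0; rewrite (first_isE _ _ x0).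
apply: (iffP andP) => [[pt rt]|[i [pi ri mi]]].
  have lt : (find p t < n.+1)%N by move: pt; rewrite has_find size_tuple.
  exists (Ordinal lt); rewrite (tnth_nth x0) /= (nth_find x0 pt); split => // j ji.
  by rewrite (tnth_nth x0) before_find.
have pt : has p t by apply/hasP; exists (tnth t i) => //; exact: mem_tnth.
split => //; suff -> : find p t = i by rewrite -tnth_nth.
have lt : (find p t < n.+1)%N by move: pt; rewrite has_find size_tuple.
apply/eqP; rewrite eqn_leq leqNgt; apply/andP; split.
  by apply/negP => /(before_find x0); rewrite -tnth_nth pi.
rewrite leqNgt; apply/negP => /(mi (Ordinal lt)).
by rewrite (tnth_nth x0) /= nth_find.
Qed.

Lemma ord_minimal n (P : 'I_n -> Prop) : (exists i, P i) ->
  exists i, P i /\ forall j : 'I_n, (j < i)%N -> ~ P j.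
Proof.
move=> [i0 /asboolP Pi0].
case: (arg_minnP (P := fun i => `[< P i >]) (fun i : 'I_n => nat_of_ord i) Pi0) => i /asboolP Pi mi.
exists i; split => // j ji /asboolP/mi.
by rewrite leqNgt ji.
Qed.

(** * Letters as elements of SU(2) *)

Section Root.
Variables (R : realType) (q : nat).
Hypothesis q2 : (2 <= q)%N.
Local Notation C := R[i].
Local Notation SU2 := (SU R 2).
Local Notation jS := (su2_j R).
Local Notation m := (2 ^ (q - 2))%N.
Implicit Types (l : letter m) (z : C).

Lemma m_gt0 : (0 < m)%N. Proof. by rewrite expn_gt0. Qed.
Local Hint Resolve m_gt0 : core.

Lemma m4E : (4 * m = 2 ^ q)%N.
Proof. by rewrite -(expnD 2 2) subnKC. Qed.

Definition zeta : C := (2 * m).-root (-1).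

Lemma zeta_half : zeta ^+ (2 * m) = -1.
Proof. by rewrite /zeta rootCK // muln_gt0. Qed.

(** The order divides [4 * m], a power of 2. A proper divisor of it would divide [2 * m], but
    [zeta ^+ (2 * m)] is -1. *)
Lemma zeta_prim : (4 * m).-primitive_root zeta.
Proof.
have z1 : zeta ^+ (4 * m) = 1.
  by rewrite -[4%N]/(2 * 2)%N -mulnA mulnC exprM zeta_half sqrrN expr1n.
have m40 : (0 < 4 * m)%N by rewrite muln_gt0.
have [d dP dm] := prim_order_exists m40 z1.
move: dm; rewrite m4E => /dvdn_pfactor -/(_ isT) [k kq dE].
have [ke|kN] := eqVneq k q; first by rewrite -ke -dE.
have : zeta ^+ (2 * m) = 1.
  apply/eqP; rewrite -(prim_order_dvd dP) dE -(expnS 2) dvdn_Pexp2l //; lia.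
rewrite zeta_half => /eqP; rewrite eq_sym -addr_eq0 -mulr2n pnatr_eq0 //.
Qed.

Lemma zeta_norm a : zeta ^+ a * (zeta ^+ a)^* = 1.
Proof.
rewrite -normCK normrX; suff -> : `|zeta| = 1 by rewrite !expr1n.
have /(congr1 (fun z => `|z|)) := zeta_half; rewrite normrX normrN normr1.
by move/eqP; rewrite pexpr_eq1 ?muln_gt0 // => /eqP.
Qed.

Lemma zeta_conj a : (zeta ^+ a)^* = (zeta ^+ a)^-1.
Proof. by apply/esym/mulr1_eq; exact: zeta_norm. Qed.

(* The letter [(a, e)] stands for the quaternion [zeta ^ a * j ^ e]. *)
Definition ltr l : SU2 := if l.2 then su2 0 (zeta ^+ l.1) else su2 (zeta ^+ l.1) 0.

Lemma ltr_al l : su2_al (ltr l) = if l.2 then 0 else zeta ^+ l.1.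
Proof.
by rewrite /ltr; case: l.2; rewrite su2_alE // ?mul0r ?add0r ?addr0 zeta_norm.
Qed.

Lemma ltr_be l : su2_be (ltr l) = if l.2 then zeta ^+ l.1 else 0.
Proof.
by rewrite /ltr; case: l.2; rewrite su2_beE // ?mul0r ?add0r ?addr0 zeta_norm.
Qed.

Lemma zeta_neq0 a : zeta ^+ a != 0.
Proof.
by apply/eqP => z0; have /eqP := zeta_norm a; rewrite z0 mul0r eq_sym oner_eq0.
Qed.

Lemma zeta_inj (a b : 'I_(4 * m)) : zeta ^+ a = zeta ^+ b -> a = b.
Proof.
move/eqP; rewrite (eq_prim_root_expr zeta_prim) !modn_small // => /eqP.
exact: val_inj.
Qed.

Lemma ltr_inj : injective ltr.
Proof.
move=> [a e] [b e'] lE; have := congr1 (@su2_al R) lE; have := congr1 (@su2_be R) lE.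
rewrite !ltr_al !ltr_be /=; case: e {lE}; case: e' => //.
- by move=> /zeta_inj ->.
- by move=> /eqP; rewrite (negPf (zeta_neq0 _)).
- by move=> /eqP; rewrite eq_sym (negPf (zeta_neq0 _)).
- by move=> _ /zeta_inj ->.
Qed.

Lemma ltr_surj (A : SU2) : su2_be A = 0 /\ su2_al A ^+ (4 * m) = 1 \/
  su2_al A = 0 /\ su2_be A ^+ (4 * m) = 1 -> exists l, ltr l = A.
Proof.
case=> -[z0 zM].
  have [a aE] := prim_rootP zeta_prim zM.
  by exists (a, false); apply: su2_eq; rewrite ?ltr_al ?ltr_be.
have [a aE] := prim_rootP zeta_prim zM.
by exists (a, true); apply: su2_eq; rewrite ?ltr_al ?ltr_be.
Qed.

(** On the unit circle, being real means having square 1, that is, [2 * m] divides the exponent. *)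
Lemma half_letterE l : half_letter l = ((zeta ^+ l.1)^* == zeta ^+ l.1).
Proof.
rewrite zeta_conj -(inj_eq (mulfI (zeta_neq0 l.1))) mulfV ?zeta_neq0 // eq_sym.
rewrite -exprD -(prim_order_dvd zeta_prim); case: l => -[a am] e.
rewrite /half_letter /= addnn -mul2n -[4%N]/(2 * 2)%N -mulnA dvdn_pmul2l //.
rewrite -[4%N]/(2 * 2)%N -mulnA in am.
apply/orP/dvdnP => [[/eqP ->|/eqP ->]|[k kE]].
- by exists 0%N.
- by exists 1%N; rewrite mul1n.
- move: am; rewrite kE ltn_pmul2r ?muln_gt0 //.
  by case: k {kE} => [|[|]] // _; [left|right]; rewrite ?mul0n ?mul1n.
Qed.

Lemma quarter_letterE l : quarter_letter l = ((zeta ^+ l.1) ^+ 4 == 1).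
Proof.
case: l => -[a am] e; rewrite /quarter_letter /= -exprM.
by rewrite -(prim_order_dvd zeta_prim) [(a * 4)%N]mulnC dvdn_pmul2l.
Qed.

Lemma j_letterE l : j_letter l = (ltr l == jS).
Proof.
have m40 : (0 < 4 * m)%N by rewrite muln_gt0.
have jE : ltr (Ordinal m40, true) = jS.
  by apply: su2_eq; rewrite ?ltr_al ?ltr_be ?su2_j_al ?su2_j_be.
rewrite -jE (inj_eq ltr_inj) /j_letter; case: l => a e /=.
by rewrite xpair_eqE eqb_id.
Qed.

End Root.

(** * The normaliser of the diagonal torus *)

Section TorusConj.
Variable R : realType.
Local Notation C := R[i].
Local Notation SU2 := (SU R 2).
Local Notation jS := (su2_j R).
Implicit Types (h x y : SU2) (z : C).

Lemma su2_conj_torus h x : su2_be h = 0 ->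
  su2_al (x ^ h)%g = su2_al x /\
  su2_be (x ^ h)%g = (su2_al h)^* ^+ 2 * su2_be x.
Proof.
move=> h0; have hn := su2_norm_al h0; rewrite conjgE !su2E h0 rmorph0.
split; last by ring.
by rewrite -[RHS]mul1r -hn; ring.
Qed.

Lemma su2_conj_refl h x : su2_al h = 0 ->
  su2_al (x ^ h)%g = (su2_al x)^* /\
  su2_be (x ^ h)%g = su2_be h ^+ 2 * (su2_be x)^*.
Proof.
move=> h0; have hn := su2_norm_be h0; rewrite conjgE !su2E h0 rmorph0.
split; last by rewrite rmorphB !rmorphM /= conjCK rmorph0; ring.
by rewrite -[RHS]mul1r -hn !rmorphD !rmorphM /= rmorph0; ring.
Qed.

Lemma su2_diag_or_anti_conj h x : su2_be h = 0 \/ su2_al h = 0 ->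
  (su2_be (x ^ h)%g == 0) = (su2_be x == 0).
Proof.
move=> hN; case: (hN) => h0.
  have [_ ->] := su2_conj_torus x h0; rewrite mulf_eq0 expf_eq0 /= conjC_eq0.
  case: eqP => // a0; have := su2_norm h.
  by rewrite h0 a0 !mul0r addr0 => /eqP; rewrite eq_sym oner_eq0.
have [_ ->] := su2_conj_refl x h0; rewrite mulf_eq0 expf_eq0 /= conjC_eq0.
case: eqP => // a0; have := su2_norm h.
by rewrite h0 a0 !mul0r addr0 => /eqP; rewrite eq_sym oner_eq0.
Qed.

(* A torus element different from [1] and [-1] has only two torus conjugates, its own
   Weyl orbit. *)
Lemma su2_torus_fusion h x y : su2_be x = 0 -> su2_be y = 0 -> ~ pm_one_set x ->
  (x ^ h)%g = y -> su2_be h = 0 \/ su2_al h = 0.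
Proof.
move=> x0 y0 xN xy; have e : (x * h = h * y)%g by rewrite -xy mulVKg.
have := congr1 (@su2_al R) e; have := congr1 (@su2_be R) e; rewrite !su2E x0 y0.
rewrite !mul0r !rmorph0 !mulr0 !subr0 !addr0 add0r.
have [->|b0] := eqVneq (su2_be h) 0; first by left.
have [->|a0] := eqVneq (su2_al h) 0; first by right.
(* If both coordinates of [h] were nonzero, [su2_al x] would equal both [su2_al y] and its
   conjugate; it would be real and [x] central. *)
rewrite [X in X = _ -> _]mulrC => /(mulfI b0) eb; rewrite mulrC => /(mulfI a0) ea.
by case: xN; apply: pm_oneP => //; rewrite {1}eb conjCK -ea.
Qed.

(** Membership in the normaliser of the diagonal torus. *)
Definition su2_diag_or_anti x := su2_be x = 0 \/ su2_al x = 0.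

Lemma su2_diag_or_antiM x y : su2_diag_or_anti x -> su2_diag_or_anti y ->
  su2_diag_or_anti (x * y)%g.
Proof.
rewrite /su2_diag_or_anti !su2E.
by case=> ->; case=> ->; rewrite ?conjC0 !su2_simpE ?oppr0 ?su2_simpE; (by left) || (by right).
Qed.

Lemma su2_diag_or_antiV x : su2_diag_or_anti x -> su2_diag_or_anti x^-1%g.
Proof.
rewrite /su2_diag_or_anti !su2E.
by case=> ->; rewrite ?conjC0 ?oppr0; (by left) || (by right).
Qed.

Lemma su2_commute_j x : commute jS x <->
  su2_be x = (su2_be x)^* /\ su2_al x = (su2_al x)^*.
Proof.
split=> [e|[eb ea]].
  have := congr1 (@su2_al R) e; have := congr1 (@su2_be R) e.
  by rewrite !su2E conjC0 conjC1 !su2_simpE => -> /oppr_inj.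
by apply: su2_eq; rewrite !su2E ?conjC0 ?conjC1 !su2_simpE -?eb -?ea.
Qed.

End TorusConj.

(** * Distinct normal forms are not conjugate *)

Section Uniqueness.
Variables (R : realType) (q : nat).
Hypothesis q2 : (2 <= q)%N.
Local Notation SU2 := (SU R 2).
Local Notation jS := (su2_j R).
Local Notation m := (2 ^ (q - 2))%N.
Local Notation ltr := (@ltr R q).
Implicit Types (l : letter m) (h : SU2).

Lemma refl_letterE l : refl_letter l = (su2_be (ltr l) != 0).
Proof. by rewrite /refl_letter ltr_be; case: l.2; rewrite ?zeta_neq0 ?eqxx. Qed.

Lemma noncentral_letterE l : reflect (~ pm_one_set (ltr l)) (noncentral_letter l).
Proof.
rewrite /noncentral_letter (half_letterE R q2).
apply: (iffP idP) => [/orP[l2|lN] /pm_one_setE lE|lN].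
- by have := refl_letterE l; rewrite /refl_letter l2; case: lE => ->; rewrite !su2E eqxx.
- have [l2|l2] := boolP l.2.
    by have := refl_letterE l; rewrite /refl_letter l2; case: lE => ->; rewrite !su2E eqxx.
  have zE : zeta R q ^+ l.1 = su2_al (ltr l) by rewrite ltr_al (negPf l2).
  by move: lN; rewrite zE; case: lE => ->; rewrite !su2E ?rmorphN rmorph1 eqxx.
- apply/negPn/negP; rewrite negb_or negbK => /andP[l2 /eqP zR]; apply: lN.
  by apply: pm_oneP; rewrite ?ltr_al ?ltr_be (negPf l2).
Qed.

Lemma nonhalf_letterE l : reflect (~ commute jS (ltr l)) (nonhalf_letter l).
Proof.
have hE : half_letter l <-> commute jS (ltr l).
  rewrite su2_commute_j ltr_be ltr_al (half_letterE R q2); case: l.2; rewrite rmorph0.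
    by split=> [/eqP ->|[<-]].
  by split=> [/eqP ->|[_ <-]].
by apply: (iffP idP) => [/negP lN /hE|lN]; last by apply/negP => /hE.
Qed.

(** The normal forms in Q_8 obey the second rule as well: no reflection precedes the first
    noncentral letter, and the angle [m] lies in the upper half. *)
Lemma accepted_refl n (t : n.-tuple (letter m)) : accepted t ->
  first_is (@refl_letter m) (@j_letter m) t /\
  first_is (@nonhalf_letter m) (@upper_letter m) t.
Proof.
rewrite /accepted; case: ifP => _ /andP[] //.
move=> /first_isP[i [_ ji mi]] /first_isP[k [nk ik mk]]; split; apply/first_isP.
  exists i; split => //; first by case/andP: ji.
  by move=> j /mi; rewrite negb_or => /andP[].
exists k; split => //; case/andP: ik => /eqP ik _.
by rewrite /upper_letter ik m_gt0 // mul2n -addnn -{1}[m]addn0 ltn_add2l m_gt0.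
Qed.

Lemma first_is_common n (p r r' : pred (letter m)) (t t' : n.-tuple (letter m)) :
  (forall i, p (tnth t i) = p (tnth t' i)) -> first_is p r t -> first_is p r' t' ->
  exists i, [/\ p (tnth t i), r (tnth t i) & r' (tnth t' i)].
Proof.
move=> pE /first_isP[i [pi ri mi]] /first_isP[j [pj rj mj]].
exists i; split => //; suff -> : i = j by [].
apply: val_inj; apply/eqP; rewrite eqn_leq; apply/andP; split; rewrite leqNgt;
  apply/negP => ji.
  by have := mi _ ji; rewrite pE pj.
by have := mj _ ji; rewrite -pE pi.
Qed.

(** A letter outside Q_8 yields a torus element [x] with [x ^ 4 <> 1]. Its conjugate lies in the
    torus normaliser and has nonzero trace, so it is diagonal, and fusion in the torus applies. *)
Lemma uniqueness_torus n (t t' : n.-tuple (letter m)) h :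
  first_is (@refl_letter m) (@j_letter m) t ->
  ~~ all (@quarter_letter m) t ->
  (forall i, (ltr (tnth t i) ^ h = ltr (tnth t' i))%g) ->
  su2_be h = 0 \/ su2_al h = 0.
Proof.
move=> /first_isP[i0 [_ ]]; rewrite (j_letterE R q2) => /eqP ti0 _.
move=> /allPn[_ /tnthP[k ->] nqk] th.
have lN l : su2_diag_or_anti (ltr l).
  by rewrite /su2_diag_or_anti ltr_al ltr_be; case: l.2; [right|left].
suff [x [x0 xE yN]] : exists x, [/\ su2_be x = 0, su2_al x = zeta R q ^+ (tnth t k).1
    & su2_diag_or_anti (x ^ h)%g].
  have x4 : su2_al x ^+ 4 <> 1.
    by rewrite xE => /eqP; apply/negP; rewrite -(quarter_letterE R q2).
  have xn := su2_norm_al x0.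
  apply: (@su2_torus_fusion _ h x (x ^ h)%g x0) => //; last first.
    move=> /pm_one_setE xpm; apply: x4.
    by case: xpm => ->; rewrite !su2E -[4%N]/(2 * 2)%N exprM ?sqrrN !expr1n.
  case: yN => // y0; have := su2_tr_conj x h.
  rewrite /su2_tr y0 conjC0 addr0 => /esym/eqP; rewrite addrC addr_eq0 => /eqP xc.
  case: x4; rewrite -[4%N]/(2 * 2)%N exprM (_ : su2_al x ^+ 2 = -1) ?sqrrN ?expr1n //.
  by apply/eqP; rewrite -eqr_oppLR -mulrN -xc xn.
(* A reflection is divided by [j], which is an entry of [t], so that the conjugate of the quotient
   is still a quotient of letters of [t']. *)
have [e|e] := boolP (tnth t k).2.
  exists (ltr (tnth t k) * jS^-1)%g; split.
  - by rewrite !su2E ltr_al ltr_be e conjCK !su2_simpE.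
  - by rewrite !su2E ltr_al ltr_be e rmorphN /= conjC1; ring.
  - rewrite conjMg conjVg -ti0 !th.
    by apply: su2_diag_or_antiM; [exact: lN|exact/su2_diag_or_antiV/lN].
by exists (ltr (tnth t k)); rewrite th ltr_al ltr_be (negPf e).
Qed.

(** Since [h] fixes [j], it is central or an antidiagonal element that inverts all angles. The
    latter would move the first nonhalf letter out of the upper half. *)
Lemma uniqueness_refl n (t t' : n.-tuple (letter m)) h :
  first_is (@refl_letter m) (@j_letter m) t ->
  first_is (@nonhalf_letter m) (@upper_letter m) t ->
  first_is (@refl_letter m) (@j_letter m) t' ->
  first_is (@nonhalf_letter m) (@upper_letter m) t' ->
  (forall i, (ltr (tnth t i) ^ h = ltr (tnth t' i))%g) ->
  su2_be h = 0 \/ su2_al h = 0 -> pm_one_set h.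
Proof.
move=> tr tn t'r t'n th hN.
have rE i : refl_letter (tnth t i) = refl_letter (tnth t' i).
  by rewrite !refl_letterE -th su2_diag_or_anti_conj.
have [i0 [_ ]] := first_is_common rE tr t'r.
rewrite !(j_letterE R q2) => /eqP ti0 /eqP t'i0.
have hj : commute jS h.
  by have := th i0; rewrite ti0 t'i0 => e; rewrite /commute -{2}e mulVKg.
have [bR aR] := (su2_commute_j h).1 hj.
case: hN => [b0|a0]; first exact: pm_oneP.
have b2 : su2_be h ^+ 2 = 1.
  by rewrite expr2 {2}bR; have := su2_norm h; rewrite a0 mul0r add0r.
exfalso.
have zE i : zeta R q ^+ (tnth t' i).1 = (zeta R q ^+ (tnth t i).1)^*.
  have [] := su2_conj_refl (ltr (tnth t i)) a0.
  rewrite th !ltr_al !ltr_be; have := rE i; rewrite /refl_letter.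
  by case: (tnth t i).2; case: (tnth t' i).2 => // _; rewrite b2 mul1r.
have nE i : nonhalf_letter (tnth t i) = nonhalf_letter (tnth t' i).
  by rewrite /nonhalf_letter !(half_letterE R q2) zE conjCK eq_sym.
have [k [_ uk u'k]] := first_is_common nE tn t'n.
(* Both exponents lie strictly between 0 and [2 * m], so their sum is no multiple of [4 * m]. *)
have : zeta R q ^+ ((tnth t k).1 + (tnth t' k).1) = 1.
  by rewrite exprD zE zeta_norm.
move=> /eqP; rewrite -(prim_order_dvd (zeta_prim R q2)) => /dvdn_leq.
move: uk u'k; rewrite /upper_letter.
have arith (a b c : nat) : (0 < a < 2 * c -> 0 < b < 2 * c ->
  ~ (0 < a + b -> 4 * c <= a + b))%N by lia.
exact: arith.
Qed.

(** Here [h] need not preserve the torus, but centrality is invariant under conjugation, and so is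
    commuting with [j] once [h] fixes [j]. Thus [h] commutes with two noncommuting elements. *)
Lemma uniqueness_quarter n (t t' : n.-tuple (letter m)) h :
  first_is (@noncentral_letter m) (@j_letter m) t ->
  first_is (@nonhalf_letter m) (@i_letter m) t ->
  first_is (@noncentral_letter m) (@j_letter m) t' ->
  first_is (@nonhalf_letter m) (@i_letter m) t' ->
  (forall i, (ltr (tnth t i) ^ h = ltr (tnth t' i))%g) -> pm_one_set h.
Proof.
move=> tc tn t'c t'n th.
have cE i : noncentral_letter (tnth t i) = noncentral_letter (tnth t' i).
  have pmJ x g : pm_one_set (R := R) (x ^ g)%g <-> pm_one_set x.
    split; last exact: pm_one_conj.
    by move=> /(pm_one_conj g^-1%g); rewrite conjgK.
  by apply/noncentral_letterE/noncentral_letterE; rewrite -th pmJ.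
have [i0 [_ ]] := first_is_common cE tc t'c.
rewrite !(j_letterE R q2) => /eqP ti0 /eqP t'i0.
have hj : (jS ^ h)%g = jS by have := th i0; rewrite ti0 t'i0.
have comJ x y g : commute (x ^ g)%g (y ^ g)%g <-> commute (x : SU2) y.
  by rewrite /commute -!conjMg; split=> [/conjg_inj|->].
have nE i : nonhalf_letter (tnth t i) = nonhalf_letter (tnth t' i).
  have e : commute jS (ltr (tnth t' i)) <-> commute jS (ltr (tnth t i)).
    by rewrite -th -{1}hj comJ.
  by apply/nonhalf_letterE/nonhalf_letterE; rewrite e.
have [k [nk]] := first_is_common nE tn t'n.
rewrite /i_letter => /andP[/eqP a1 /negPf e1] /andP[/eqP a2 /negPf e2].
have ttk : ltr (tnth t k) = ltr (tnth t' k) by apply: su2_eq; rewrite ?ltr_al ?ltr_be a1 a2 e1 e2.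
have hk : commute (ltr (tnth t k)) h.
  by have := th k; rewrite -ttk => e; rewrite /commute -{2}e mulVKg.
have hjj : commute jS h by rewrite /commute -{2}hj mulVKg.
apply: contrapT => hN; move/nonhalf_letterE: nk; apply.
by apply: (su2_commute_trans hN); exact: commute_sym.
Qed.

Lemma accepted_unique n (t t' : n.-tuple (letter m)) h :
  accepted t -> accepted t' ->
  (forall i, (ltr (tnth t i) ^ h = ltr (tnth t' i))%g) -> pm_one_set h.
Proof.
move=> ta t'a th; have [tr tn] := accepted_refl ta; have [t'r t'n] := accepted_refl t'a.
have [tq|tq] := boolP (all (@quarter_letter m) t); last first.
  exact: (uniqueness_refl tr tn t'r t'n th (uniqueness_torus tr tq th)).
have [t'q|t'q] := boolP (all (@quarter_letter m) t').
  move: ta t'a; rewrite /accepted tq t'q => /andP[tc ti] /andP[t'c t'i].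
  exact: (uniqueness_quarter tc ti t'c t'i th).
(* Only [t'] determines its torus here, so the argument runs backwards, with [h^-1]. *)
have th' i : (ltr (tnth t' i) ^ h^-1 = ltr (tnth t i))%g by rewrite -th conjgK.
have := uniqueness_refl t'r t'n tr tn th' (uniqueness_torus t'r t'q th').
by have [_ _ pV] := pm_one_subgroup R => /pV; rewrite invgK.
Qed.

End Uniqueness.

Lemma subgroup_free_lift n (G : groupType) (S : set G) (g : 'I_n -> G) x :
  is_subgroup S -> (forall i, S (g i)) -> S (free_lift g x).
Proof.
move=> [S1 SM SV] Sg; rewrite -[x]reprF free_lift_pi /word_eval.
elim: (repr x) => [|l u IH]; first by rewrite big_nil.
rewrite big_cons; apply: SM => //; rewrite /letter_eval.
by case: l.2; [|apply: SV].
Qed.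

(** * Every noncommuting tuple is conjugate into the generalised quaternion group *)

Section Existence.
Variables (R : realType) (q : nat).
Hypothesis q2 : (2 <= q)%N.
Local Notation C := R[i].
Local Notation SU2 := (SU R 2).
Local Notation m1 := (su2_m1 R).
Local Notation iS := (su2_i R).
Local Notation jS := (su2_j R).
Local Notation m := (2 ^ (q - 2))%N.
Local Notation ltr := (@ltr R q).
Implicit Types (l : letter m) (h x y : SU2) (z : C).

(* The generalised quaternion group of order [2 ^ q.+1], and then the terms of its
   lower central series. *)
Definition quat_lcs k : set SU2 :=
  if k is _.+1 then [set x | su2_be x = 0 /\ su2_al x ^+ (2 ^ (q - k)) = 1]
  else [set x | su2_be x = 0 /\ su2_al x ^+ (2 ^ q) = 1 \/
                su2_al x = 0 /\ su2_be x ^+ (2 ^ q) = 1].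

Lemma conjCX_eq1 z k : z ^+ k = 1 -> z^* ^+ k = 1.
Proof. by move=> zk; rewrite -rmorphXn zk rmorph1. Qed.

Lemma opp_pow2q z : z ^+ (2 ^ q) = 1 -> (- z) ^+ (2 ^ q) = 1.
Proof.
move=> zk; rewrite exprNn zk mulr1; case: q q2 => // k _.
by rewrite expnS exprM sqrrN !expr1n.
Qed.

Lemma quat_lcs_subgroup k : is_subgroup (quat_lcs k).
Proof.
case: k => [|k]; split.
- by left; rewrite !su2E expr1n.
- move=> x y; rewrite /quat_lcs /= !su2E.
  case=> -[-> xq] [] [-> yq]; rewrite ?conjC0 !su2_simpE.
  + by left; rewrite exprMn xq yq mulr1.
  + by right; rewrite exprMn xq yq mulr1.
  + by right; rewrite exprMn xq conjCX_eq1 ?mulr1.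
  + by left; split=> //; apply: opp_pow2q; rewrite exprMn xq conjCX_eq1 ?mulr1.
- move=> x; rewrite /quat_lcs /= !su2E.
  case=> -[-> xq]; rewrite ?conjC0 ?su2_simpE.
  + by left; rewrite conjCX_eq1.
  + by right; rewrite opp_pow2q.
- by rewrite /quat_lcs /= !su2E expr1n.
- move=> x y; rewrite /quat_lcs /= !su2E => -[-> xq] [-> yq].
  by rewrite !su2_simpE exprMn xq yq mulr1.
- move=> x; rewrite /quat_lcs /= !su2E => -[-> xq].
  by rewrite !su2_simpE conjCX_eq1.
Qed.

Lemma half_exponent z k : z ^+ (2 ^ (q - k)) = 1 -> z ^+ 2 ^+ (2 ^ (q - k.+1)) = 1.
Proof.
move=> zk; rewrite -exprM -expnS.
have [kq|qk] := ltnP k q; first by rewrite -subSn // subSS.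
(* For [k] at least [q] the truncated difference is 0 and the exponent is 1. *)
have z1 : z = 1 by move: zk; rewrite (eqP (_ : q - k == 0)%N) ?expn0 ?expr1.
by rewrite z1 expr1n.
Qed.

(** An antidiagonal [y] inverts the torus, so the commutator is [x ^ -2]. *)
Lemma su2_torus_comm x y : su2_be x = 0 -> su2_al y = 0 ->
  su2_be [~ x, y]%g = 0 /\ su2_al [~ x, y]%g = (su2_al x)^* ^+ 2.
Proof.
move=> x0 y0; have [a b] := su2_conj_refl x y0.
by rewrite commgEl (su2_alM x^-1%g) (su2_beM x^-1%g) !(su2_alV, su2_beV) a b x0 conjC0 !su2_simpE; split.
Qed.

(** A commutator of two elements of the group is the square of a torus element, possibly trivial;
    hence each step halves the exponent. *)
Lemma quat_lcsS k x y : quat_lcs k x -> quat_lcs 0 y -> quat_lcs k.+1 [~ x, y]%g.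
Proof.
have diag j : su2_be x = 0 -> su2_al x ^+ (2 ^ (q - j)) = 1 -> quat_lcs 0 y ->
    quat_lcs j.+1 [~ x, y]%g.
  move=> x0 xq [] [y0 _].
    have [a b] := su2_conj_torus x y0.
    have -> : [~ x, y]%g = 1%g; last by rewrite /quat_lcs /= !su2E expr1n.
    rewrite commgEl; have -> : (x ^ y)%g = x; last by rewrite mulVg.
    by apply: su2_eq; rewrite ?a ?b ?x0 ?mulr0.
  have [a b] := su2_torus_comm x0 y0; split=> //.
  by rewrite b; apply: half_exponent; apply: conjCX_eq1.
case: k => [|k]; last by move=> [x0 xq]; exact: (diag k.+1).
case=> -[x0 xq] Py; first by apply: diag => //; rewrite subn0.
have xn := su2_norm_be x0.
case: Py => -[y0 yq].
  have [a b] := su2_conj_torus x y0; split; rewrite commgEl ?(su2_alM x^-1%g) ?(su2_beM x^-1%g) !(su2_alV, su2_beV) a b x0 ?conjC0 !su2_simpE //.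
  rewrite !rmorphM /= conjCK.
  have -> : - (- su2_be x * (su2_al y * su2_al y * (su2_be x)^*)) = su2_al y ^+ 2.
    by rewrite -[RHS]mul1r -xn; ring.
  by apply: (@half_exponent _ 0); rewrite subn0.
have [a b] := su2_conj_refl x y0; split; rewrite commgEl ?(su2_alM x^-1%g) ?(su2_beM x^-1%g) !(su2_alV, su2_beV) a b x0 ?conjC0 !su2_simpE //.
have -> : - (- su2_be x * (su2_be y ^+ 2 * (su2_be x)^*)^*)
    = (su2_be x * (su2_be y)^*) ^+ 2.
  by rewrite !rmorphM /= conjCK; ring.
apply: (@half_exponent _ 0); rewrite subn0 exprMn xq mul1r; exact: conjCX_eq1.
Qed.

Lemma quat_lcs_end x : quat_lcs q x -> x = 1%g.
Proof.
rewrite /quat_lcs; case: q q2 => // k _ /=; rewrite subnn expn0 expr1 => -[b0 a1].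
by apply: su2_eq; rewrite !su2E.
Qed.

Lemma ltr_quat l : quat_lcs 0 (ltr l).
Proof.
rewrite /quat_lcs /= ltr_al ltr_be -(m4E q2).
by case: l.2; [right|left]; rewrite exprAC (prim_expr_order (zeta_prim R q2)) expr1n.
Qed.

Lemma ltr_hom_lcs n (t : n.-tuple (letter m)) (x : freeGroup n) :
  lcs_set q.+1 x -> free_lift (fun i => ltr (tnth t i)) x = 1%g.
Proof.
have lM := @free_liftM n _ (fun i => ltr (tnth t i)).
have P0 (y : freeGroup n) : quat_lcs 0 (free_lift (fun i => ltr (tnth t i)) y).
  by apply: subgroup_free_lift => [|i]; [exact: quat_lcs_subgroup|exact: ltr_quat].
move=> /(lcs_image lM quat_lcs_subgroup P0 (fun k u v (Pu : quat_lcs k u) => quat_lcsS Pu (P0 v))).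
exact: quat_lcs_end.
Qed.

Lemma exists_torus_form n (phi : freeGroup n -> SU2) :
  {morph phi : x y / (x * y)%g} ->
  (forall w : freeGroup n, lcs_set q.+1 w -> phi w = 1%g) ->
  (exists i j, ~ commute (phi (free_gen i)) (phi (free_gen j))) ->
  exists h (f : 'I_n -> letter m) i0,
    [/\ forall i, (phi (free_gen i) ^ h)%g = ltr (f i), j_letter (f i0)
      & forall i : 'I_n, (i < i0)%N -> ~~ refl_letter (f i)].
Proof.
move=> phiM phiq [i [j gij]].
have pm1 : pm_one_set (1%g : SU2) by have [] := pm_one_subgroup R.
(* [y] is a noncentral element of the last noncentral term of the series: it
   commutes with everything up to sign. *)
have [k [[y ly yN] yS]] : exists k, (exists2 w : freeGroup n, lcs_set k.+1 w & ~ pm_one_set (phi w))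
    /\ forall w : freeGroup n, lcs_set k.+2 w -> pm_one_set (phi w).
  apply: contrapT => nex.
  (* Otherwise noncentral values would persist through the whole series; they exist at the start
     because two generators do not commute, but at the term [q.+1] all values are 1. *)
  have nP k : exists2 w : freeGroup n, lcs_set k.+1 w & ~ pm_one_set (phi w).
    elim: k => [|k [y ly yN]].
      exists (free_gen i) => // /pm_one_setE gE; apply: gij.
      case: gE => ->; last exact: su2_m1C.
      exact/commute_sym/commute1.
    apply: contrapT => nk; apply: nex; exists k; split; first by exists y.
    by move=> w lw; apply: contrapT => wN; apply: nk; exists w.
  by have [w /phiq -> ] := nP q.
set x := phi y.
have xJ w : (x ^ phi w = x)%g \/ (x ^ phi w = m1 * x)%g.
  have : pm_one_set (phi [~ y, w]%g) by apply: yS; exact: lcs_commg.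
  rewrite (morphRg phiM) commgEl -/x pm_one_setE.
  case=> /(congr1 (fun v : SU2 => x * v)%g); rewrite mulVKg => ->; [left|right].
    by rewrite mulg1.
  by rewrite su2_m1C.
have xC w : (x ^ w = x)%g <-> commute x w.
  by split=> [e|e]; [rewrite /commute -{2}e mulVKg | rewrite conjgE e mulKg].
(* If all generators commuted with the noncentral [x], they would commute with each other.
   Minimality puts the earlier generators into the torus through [x], so [i0] becomes the first
   reflection. *)
have [i0 [n0 lt0]] : exists i, ~ commute x (phi (free_gen i)) /\
    forall j : 'I_n, (j < i)%N -> ~ ~ commute x (phi (free_gen j)).
  apply: ord_minimal; apply: contrapT => nex; apply: gij.
  apply: (su2_commute_trans yN); apply: contrapT => e; apply: nex.
    by exists i.
  by exists j.
set y0 := phi (free_gen i0) in n0.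
have xy0 : (x ^ y0 = m1 * x)%g by case: (xJ (free_gen i0)) => // /xC.
have yx0 : (x * y0 = m1 * (y0 * x))%g.
  by rewrite -[LHS](mulVKg y0) -conjgE xy0 !mulgA su2_m1C.
have yx : (y0 * x = m1 * (x * y0))%g by rewrite yx0 mulgA su2_m1_sq mul1g.
have y0x : (y0 ^ x = m1 * y0)%g.
  by rewrite conjgE yx mulgA -su2_m1C -mulgA mulKg.
have [h [xh yh]] := su2_pair (su2_sq (su2_tr_anti xy0)) (su2_sq (su2_tr_anti y0x)) yx
  (su2_i_sq R) (su2_j_sq R) (su2_ji R).
have iJ w : (iS ^ (phi w ^ h) = iS)%g \/ (iS ^ (phi w ^ h) = m1 * iS)%g.
  rewrite -xh -conjJg; case: (xJ w) => ->; [by left|right].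
  by rewrite conjMg su2_m1J.
have lN w : su2_be (phi w ^ h)%g = 0 \/ su2_al (phi w ^ h)%g = 0.
  by case: (iJ w) => [/su2_fix_i|/su2_neg_i]; [left|right].
(* Induction on the distance [d] to the trivial term: the commutator with the generator at [i0], now
   [j], lies one term deeper and is the inverse square. *)
have pw d : forall j w, (j + d = q)%N -> lcs_set j.+1 w -> su2_be (phi w ^ h)%g = 0 ->
    su2_al (phi w ^ h)%g ^+ (2 ^ d) = 1.
  elim: d => [|d IH] j' w.
    by rewrite addn0 => -> /phiq -> _; rewrite conj1g su2E expr1.
  rewrite addnS -addSn => jd lw w0.
  have := IH _ [~ w, free_gen i0]%g jd (lcs_commg _ lw).
  rewrite (morphRg phiM) conjRg yh.
  have [-> ->] := su2_torus_comm w0 (su2_j_al R).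
  move=> /(_ erefl) /conjCX_eq1; rewrite rmorphXn /= conjCK -exprM.
  by rewrite -expnS.
have fE w : exists l, (phi (free_gen w) ^ h)%g = ltr l.
  suff [l <-] : exists l, ltr l = (phi (free_gen w) ^ h)%g by exists l.
  apply: (ltr_surj q2); rewrite (m4E q2).
  case: (lN (free_gen w)) => w0; [left|right]; split => //.
    exact: (pw q 0%N).
  (* An antidiagonal value is divided by [j] to obtain a torus value with the same root of unity. *)
  have := pw q 0%N (free_gen w * (free_gen i0)^-1)%g (add0n q) I.
  rewrite phiM (morphVg phiM) conjMg conjVg yh.
  rewrite (su2_alM _ jS^-1%g) (su2_beM _ jS^-1%g) !(su2_alV, su2_beV) w0.
  rewrite su2_j_al su2_j_be conjCK rmorphN /= conjC1 !mulrN1 opprK !su2_simpE.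
  exact.
have [f ff] := boolp.choice fE.
exists h, f, i0; split => //; first by rewrite (j_letterE R q2) -ff -/y0 yh.
move=> w /lt0/contrapT/xC xw; rewrite (refl_letterE R) -ff negbK.
by apply/eqP/su2_fix_i; rewrite -xh -conjJg xw.
Qed.

Lemma exists_refl_form n (phi : freeGroup n -> SU2) :
  {morph phi : x y / (x * y)%g} ->
  (forall w : freeGroup n, lcs_set q.+1 w -> phi w = 1%g) ->
  (exists i j, ~ commute (phi (free_gen i)) (phi (free_gen j))) ->
  exists h (t : n.-tuple (letter m)),
    [/\ forall i, (phi (free_gen i) ^ h)%g = ltr (tnth t i),
      first_is (@refl_letter m) (@j_letter m) t
      & first_is (@nonhalf_letter m) (@upper_letter m) t].
Proof.
move=> phiM phiq gN; have [h [f [i0 [ff ji0 lt0]]]] := exists_torus_form phiM phiq gN.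
have jN : ~ pm_one_set jS.
  by move=> /pm_one_setE jE; have := su2_j_be R; case: jE => ->;
     rewrite !su2E => /esym/eqP; rewrite oner_eq0.
have [i1 [n1 lt1]] : exists i, nonhalf_letter (f i) /\
    forall j : 'I_n, (j < i)%N -> ~ nonhalf_letter (f j).
  apply: ord_minimal; apply: contrapT => nex.
  have cj i : commute jS (ltr (f i)).
    by apply: contrapT => ci; apply: nex; exists i; exact/(nonhalf_letterE R q2).
  case: gN => i [j]; apply; have := su2_commute_trans jN (cj i) (cj j).
  by rewrite -!ff /commute -!conjMg => /conjg_inj.
have rj : refl_letter (f i0) by case/andP: ji0.
have [u1|u1] := boolP (upper_letter (f i1)).
  exists h, (mktuple f); split=> [i||]; rewrite ?tnth_mktuple //; apply/first_isP.
    by exists i0; rewrite tnth_mktuple; split => // j /lt0; rewrite tnth_mktuple.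
  by exists i1; rewrite tnth_mktuple; split => // j /lt1/negP; rewrite tnth_mktuple.
(* Conjugation by [jS] inverts the torus, which moves the letter at [i1] to the
   upper half circle. *)
have gE i : exists l, (ltr (f i) ^ jS)%g = ltr l.
  suff [l <-] : exists l, ltr l = (ltr (f i) ^ jS)%g by exists l.
  have [a b] := su2_conj_refl (ltr (f i)) (su2_j_al R).
  apply: (ltr_surj q2); rewrite a b su2_j_be expr1n mul1r (m4E q2).
  case: (ltr_quat (f i)) => -[-> fq]; [left|right]; split; rewrite ?conjC0 //;
    exact: conjCX_eq1.
have [f' ff'] := boolp.choice gE.
have rE i : refl_letter (f' i) = refl_letter (f i).
  by rewrite !(refl_letterE R) -ff' su2_diag_or_anti_conj //; right; exact: su2_j_al.
have zE i : zeta R q ^+ (f' i).1 = (zeta R q ^+ (f i).1)^*.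
  have [] := su2_conj_refl (ltr (f i)) (su2_j_al R).
  rewrite ff' !ltr_al !ltr_be su2_j_be expr1n mul1r; have := rE i; rewrite /refl_letter.
  by case: (f i).2; case: (f' i).2.
have nE i : nonhalf_letter (f' i) = nonhalf_letter (f i).
  by rewrite /nonhalf_letter !(half_letterE R q2) zE conjCK eq_sym.
exists (h * jS)%g, (mktuple f'); split=> [i||].
- by rewrite conjgM ff ff' tnth_mktuple.
- apply/first_isP; exists i0; rewrite tnth_mktuple rE; split => // [|j /lt0].
    rewrite (j_letterE R q2) -ff'; move: ji0; rewrite (j_letterE R q2) => /eqP ->.
    by rewrite conjgE mulKg.
  by rewrite tnth_mktuple rE.
- apply/first_isP; exists i1; rewrite tnth_mktuple nE; split => // [|j /lt1/negP].
    have : zeta R q ^+ ((f i1).1 + (f' i1).1) = 1 by rewrite exprD zE zeta_norm.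
    move=> /eqP; rewrite -(prim_order_dvd (zeta_prim R q2)) => /dvdnP[k].
    move: u1 n1; rewrite /upper_letter /nonhalf_letter /half_letter.
    have := ltn_ord (f i1).1; have := ltn_ord (f' i1).1.
    (* The two exponents add up to a positive multiple of [4 * m] below [8 * m], hence to [4 * m]:
       one in the lower half puts the other in the upper half. *)
    have arith (a b c k' : nat) : (b < 4 * c -> a < 4 * c -> ~~ (0 < a < 2 * c) ->
      ~~ ((a == 0%N) || (a == 2 * c)) -> a + b = k' * (4 * c) -> 0 < b < 2 * c)%N by case: k' => [|[|k']]; [lia|lia|nia].
    exact: arith.
  by rewrite tnth_mktuple nE.
Qed.

End Existence.

(** * The choice of a torus for tuples in Q_8 *)

Section Acceptance.
Variables (R : realType) (q : nat).
Hypothesis q2 : (2 <= q)%N.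
Local Notation C := R[i].
Local Notation SU2 := (SU R 2).
Local Notation m1 := (su2_m1 R).
Local Notation jS := (su2_j R).
Local Notation m := (2 ^ (q - 2))%N.
Local Notation ltr := (@ltr R q).
Implicit Types (l : letter m) (h x y : SU2) (z : C).

Lemma pm_oneJ x h : pm_one_set (x ^ h)%g <-> pm_one_set x.
Proof.
split; last exact: pm_one_conj.
by move=> /(pm_one_conj h^-1%g); rewrite conjgK.
Qed.

Lemma fourth_root z : z ^+ 4 = 1 -> z ^+ 2 = 1 \/ z ^+ 2 = -1.
Proof.
rewrite -[4%N]/(2 * 2)%N exprM => /eqP; rewrite sqrf_eq1.
by case/orP => /eqP ->; [left|right].
Qed.

Lemma conj_sign z : z * z^* = 1 -> z^* = z \/ z^* = - z -> z ^+ 4 = 1.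
Proof.
move=> zn zc; rewrite -[4%N]/(2 * 2)%N exprM (expr2 z).
case: zc zn => ->; first by move=> ->; rewrite expr1n.
by rewrite mulrN => /(canRL (@opprK _)) ->; rewrite sqrrN expr1n.
Qed.

Lemma su2_sign x y z : z = 1 \/ z = -1 ->
  su2_al y = z * su2_al x -> su2_be y = z * su2_be x -> y = x \/ y = (m1 * x)%g.
Proof.
by case=> -> ea eb; [left|right]; apply: su2_eq; rewrite ?su2E ?ea ?eb ?su2_simpE.
Qed.

(** Q_8 modulo its centre is abelian. *)
Lemma quarter_conj l l' : quarter_letter l -> quarter_letter l' ->
  (ltr l ^ ltr l' = ltr l)%g \/ (ltr l ^ ltr l' = m1 * ltr l)%g.
Proof.
rewrite !(quarter_letterE R q2) => /eqP /fourth_root z2 /eqP /fourth_root w2.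
have sgn (u v : C) : u ^+ 2 = 1 \/ u ^+ 2 = -1 -> v ^+ 2 = 1 \/ v ^+ 2 = -1 ->
    (u * v) ^+ 2 = 1 \/ (u * v) ^+ 2 = -1.
  by case=> eu; case=> ev; rewrite exprMn eu ev ?mulrNN ?mulr1 ?mul1r; (by left) || (by right).
have sgnJ (u : C) : u ^+ 2 = 1 \/ u ^+ 2 = -1 -> u^* ^+ 2 = 1 \/ u^* ^+ 2 = -1.
  by rewrite -rmorphXn; case=> -> /=; rewrite ?rmorphN rmorph1; [left|right].
have conjE k : (zeta R q ^+ k)^* = (zeta R q ^+ k)^* ^+ 2 * zeta R q ^+ k.
  by rewrite -[LHS]mulr1 -(zeta_norm R q k); ring.
have [l'2|l'2] := boolP l'.2.
  have h0 : su2_al (ltr l') = 0 by rewrite ltr_al l'2.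
  have [] := su2_conj_refl (ltr l) h0; rewrite !ltr_al !ltr_be l'2.
  have [l2|l2] := boolP l.2 => a b.
    apply: (su2_sign (sgn _ _ w2 (sgnJ _ z2))); rewrite ?a ?b ?ltr_al ?ltr_be l2 ?conjC0 ?su2_simpE //.
    by rewrite [X in _ * X = _]conjE; ring.
  apply: (su2_sign (sgnJ _ z2)); rewrite ?a ?b ?ltr_al ?ltr_be (negPf l2) ?conjC0 ?su2_simpE //.
have h0 : su2_be (ltr l') = 0 by rewrite ltr_be (negPf l'2).
have [a b] := su2_conj_torus (ltr l) h0.
have [l2|l2] := boolP l.2.
  apply: (su2_sign (sgnJ _ w2)); rewrite ?a ?b ?ltr_al ?ltr_be l2 ?su2_simpE //.
  by rewrite (negPf l'2).
by left; apply: su2_eq; rewrite ?a ?b // ltr_be (negPf l2) mulr0.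
Qed.

Lemma m_lt : (m < 4 * m)%N.
Proof. by rewrite -{1}[m]mul1n ltn_pmul2r // m_gt0. Qed.

Lemma i_letter_exists : exists l u,
  [/\ i_letter l, u = ltr l, su2_be u = 0 & su2_al u * su2_al u = -1].
Proof.
exists (Ordinal m_lt, false), (ltr (Ordinal m_lt, false)).
split; rewrite ?ltr_be ?ltr_al //; first by rewrite /i_letter /= eqxx.
by rewrite -exprD addnn -mul2n zeta_half.
Qed.

(** An element of the torus normaliser that commutes with [j] up to sign has a coordinate that is
    real or purely imaginary, so it belongs to Q_8. *)
Lemma sign_fourth x : su2_be x = 0 \/ su2_al x = 0 ->
  (jS ^ x = jS)%g \/ (jS ^ x = m1 * jS)%g ->
  exists l, ltr l = x /\ quarter_letter l.
Proof.
move=> xN xj.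
have jx : exists2 s : C, s = 1 \/ s = -1 & su2_al (jS * x)%g = s * su2_al (x * jS)%g
    /\ su2_be (jS * x)%g = s * su2_be (x * jS)%g.
  have -> : (jS * x = x * jS ^ x)%g by rewrite conjgE mulVKg.
  case: xj => ->.
    by exists 1; [left|rewrite !mul1r].
  exists (-1); first by right.
  by rewrite mulgA -su2_m1C -mulgA ![_ (m1 * _)%g]su2E !su2E; split; ring.
case: jx => s ss; rewrite !su2E ?conjC0 ?conjC1 !su2_simpE => -[ja jb].
have dm z : z ^+ 4 = 1 -> z ^+ (4 * m) = 1 by move=> z4; rewrite exprM z4 expr1n.
case: xN => x0.
  have x4 : su2_al x ^+ 4 = 1.
    apply: conj_sign; first exact: su2_norm_al.
    by rewrite jb; case: ss => ->; rewrite ?mul1r ?mulN1r; [left|right].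
  have [|l lE] := @ltr_surj R q q2 x; first by left; split=> //; exact: dm.
  exists l; split => //; rewrite (quarter_letterE R q2).
  move: x4 x0; rewrite -lE ltr_al ltr_be; case: l.2 => [_ /eqP|->] //.
  by rewrite (negPf (zeta_neq0 _ _ _)).
have x4 : su2_be x ^+ 4 = 1.
  apply: conj_sign; first exact: su2_norm_be.
  by case: ss ja => ->; rewrite ?mul1r ?mulN1r => /oppr_inj ->; [left|right].
have [|l lE] := @ltr_surj R q q2 x; first by right; split=> //; exact: dm.
exists l; split => //; rewrite (quarter_letterE R q2).
move: x4 x0; rewrite -lE ltr_al ltr_be; case: l.2 => [->|_ /eqP] //.
by rewrite (negPf (zeta_neq0 _ _ _)).
Qed.

(** Outside Q_8 the word is already in normal form. Inside, the first noncentral letter [Y] and the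
    first letter [X] not commuting with it are moved to [j] and to the [i_letter], which may change
    the torus. *)
Lemma exists_accepted n (g : 'I_n -> SU2) (t : n.-tuple (letter m)) h :
  (forall i, (g i ^ h)%g = ltr (tnth t i)) ->
  first_is (@refl_letter m) (@j_letter m) t ->
  first_is (@nonhalf_letter m) (@upper_letter m) t ->
  exists h' (t' : n.-tuple (letter m)),
    accepted t' /\ forall i, (g i ^ h')%g = ltr (tnth t' i).
Proof.
move=> gt tr tn; have [tq|tq] := boolP (all (@quarter_letter m) t); last first.
  by exists h, t; rewrite /accepted (negPf tq) tr tn.
have tqi i : quarter_letter (tnth t i) by move/all_tnthP: tq; apply.
move: tr tn => /first_isP[a [ra ja _]] /first_isP[b [nb _ _]].
have naj : noncentral_letter (tnth t a) by apply/orP; left.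
have jN : ~ pm_one_set jS.
  by move: naj => /(noncentral_letterE R q2); rewrite (eqP (_ : ltr _ == jS)) // -(j_letterE R q2).
have [i0 [n0 lt0]] : exists i, noncentral_letter (tnth t i) /\
    forall j : 'I_n, (j < i)%N -> ~ noncentral_letter (tnth t j).
  by apply: ord_minimal; exists a.
have [i1 [n1 lt1]] : exists i, ~ commute (ltr (tnth t i0)) (ltr (tnth t i)) /\
    forall j : 'I_n, (j < i)%N -> ~ ~ commute (ltr (tnth t i0)) (ltr (tnth t j)).
  apply: ord_minimal; apply: contrapT => nex.
  have c i : commute (ltr (tnth t i0)) (ltr (tnth t i)).
    by apply: contrapT => ci; apply: nex; exists i.
  move/(nonhalf_letterE R q2): nb; apply.
  have <- : ltr (tnth t a) = jS by apply/eqP; rewrite -(j_letterE R q2).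
  by apply: (su2_commute_trans _ (c a) (c b)); apply/(noncentral_letterE R q2).
set Y := ltr (tnth t i0) in n1 lt1; set X := ltr (tnth t i1) in n1.
have cJ (u v : SU2) : (u ^ v)%g = u <-> commute u v.
  by split=> [e|e]; [rewrite /commute -{2}e mulVKg | rewrite conjgE e mulKg].
have XY : (X ^ Y = m1 * X)%g.
  by case: (quarter_conj (tqi i1) (tqi i0)) => // /cJ /commute_sym.
have YX : (Y ^ X = m1 * Y)%g.
  by case: (quarter_conj (tqi i0) (tqi i1)) => // /cJ.
have yx : (Y * X = m1 * (X * Y))%g.
  by rewrite -[LHS](mulVKg X) -conjgE YX mulgA -su2_m1C -mulgA.
have [li [u [liE uE u0 u2]]] := i_letter_exists.
have iN := su2_imag_noncentral u2.
have [k [Xk Yk]] := su2_pair (su2_sq (su2_tr_anti XY)) (su2_sq (su2_tr_anti YX)) yx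
  (su2_imag_sq u0 u2) (su2_j_sq R) (su2_imag_j u0 u2).
(* Each letter fixes [X] and [Y] up to sign, so its conjugate does the same to [u] and [j]: the
   former puts it into the torus normaliser, the latter into Q_8. *)
have fE i : exists l, ltr l = (ltr (tnth t i) ^ k)%g /\ quarter_letter l.
  set v := ltr (tnth t i); apply: sign_fourth; last first.
    rewrite -Yk -conjJg; case: (quarter_conj (tqi i0) (tqi i)) => ->; first by left.
    by right; rewrite conjMg su2_m1J.
  have uX : (u ^ (v ^ k) = u)%g \/ (u ^ (v ^ k) = m1 * u)%g.
    rewrite -Xk -conjJg; case: (quarter_conj (tqi i1) (tqi i)) => ->; first by left.
    by right; rewrite conjMg su2_m1J.
  case: uX => e; apply: (su2_torus_fusion u0 _ iN e) => //.
  by rewrite su2_beM u0 su2_m1_be !su2_simpE.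
have [f ff] := boolp.choice fE.
exists (h * k)%g, (mktuple f); split; last first.
  by move=> i; rewrite conjgM gt tnth_mktuple (ff i).1.
rewrite /accepted (_ : all _ _); last first.
  by apply/all_tnthP => i; rewrite tnth_mktuple; exact: (ff i).2.
have ncE i : noncentral_letter (f i) = noncentral_letter (tnth t i).
  by apply/(noncentral_letterE R q2)/(noncentral_letterE R q2); rewrite (ff i).1 pm_oneJ.
have nhE i : nonhalf_letter (f i) <-> ~ commute Y (ltr (tnth t i)).
  split=> [/(nonhalf_letterE R q2)|] c; last apply/(nonhalf_letterE R q2).
    by move=> e; apply: c; rewrite (ff i).1 -Yk /commute -!conjMg e.
  by rewrite (ff i).1 -Yk /commute -!conjMg => /conjg_inj.
apply/andP; split; apply/first_isP.
  exists i0; rewrite tnth_mktuple ncE n0 (j_letterE R q2) (ff i0).1 -/Y Yk eqxx.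
  by split=> // j /lt0/negP; rewrite tnth_mktuple ncE.
exists i1; rewrite tnth_mktuple; split; first exact/nhE.
  have : ltr (f i1) = ltr li by rewrite (ff i1).1 -uE.
  by move/(ltr_inj q2) ->.
by move=> j /lt1 c; rewrite tnth_mktuple; apply/negP => /nhE.
Qed.

End Acceptance.

(** * The homeomorphism *)

Lemma continuous_mulg (T : topologicalType) (G : topologicalGroupType) (f g : T -> G) :
  continuous f -> continuous g -> continuous (fun t => (f t * g t)%g).
Proof.
move=> fc gc t; apply: (@continuous_comp _ _ _ (fun t => (f t, g t))
  (fun p : G * G => (p.1 * p.2)%g)); last exact: mulg_continuous.
exact: (cvg_pair (fc t) (gc t)).
Qed.

Lemma continuous_conjg (G : topologicalGroupType) (x : G) :
  continuous (fun g : G => (x ^ g)%g).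
Proof.
apply: (continuous_mulg (@invg_continuous G)); apply: continuous_mulg.
  exact: cst_continuous.
by move=> g; exact: cvg_id.
Qed.

Section Classification.
Variables (R : realType) (q n : nat).
Hypothesis q2 : (2 <= q)%N.
Local Notation SU2 := (SU R 2).
Local Notation jS := (su2_j R).
Local Notation m := (2 ^ (q - 2))%N.
Local Notation ltr := (@ltr R q).
Local Notation Gamma := (quotientGroup (lcs (freeGroup n) q.+1)).
Local Notation nil_gen := (@nil_gen n q.+1).
Implicit Types (t : n.-tuple (letter m)).

Definition word_hom t (x : Gamma) : SU2 := free_lift (fun i => ltr (tnth t i)) (repr x).

Lemma word_hom_lcs t (x : freeGroup n) : ns_set (lcs (freeGroup n) q.+1) x ->
  free_lift (fun i => ltr (tnth t i)) x = 1%g.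
Proof. exact: ltr_hom_lcs. Qed.

Lemma word_homM t : {morph word_hom t : x y / (x * y)%g}.
Proof. exact: (quot_lift_morph (@free_liftM n _ _) (@word_hom_lcs t)). Qed.

Lemma word_hom_gen t i : word_hom t (nil_gen i) = ltr (tnth t i).
Proof.
rewrite /word_hom (quot_lift_pi (@free_liftM n _ _) (@word_hom_lcs t)).
exact: free_lift_gen.
Qed.

Lemma conj_hom_morph t (g : SU2) : {morph (fun x => word_hom t x ^ g)%g : x y / (x * y)%g}.
Proof. by move=> x y; rewrite word_homM conjMg. Qed.

Definition conj_hom t (g : SU2) : HomSpace Gamma SU2 :=
  exist _ ((fun x => word_hom t x ^ g)%g : {ptws Gamma -> SU2}) (mem_set (conj_hom_morph t g)).

Lemma conj_hom_continuous t : continuous (conj_hom t).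
Proof.
by apply: continuous_to_HomSpace => x; exact: continuous_conjg.
Qed.

Lemma pm_one_conj_id (x g : SU2) : pm_one_set g -> (x ^ g = x)%g.
Proof.
move=> /pm_one_setE[] ->; first by rewrite conjg1.
by rewrite conjgE -su2_m1C mulKg.
Qed.

Definition conj_hom_PU2 t (c : PU2 R) : HomSpace Gamma SU2 := conj_hom t (repr c).

Lemma conj_hom_PU2_continuous t : continuous (conj_hom_PU2 t).
Proof.
apply: (@repr_comp_continuous _ (quotientGroup (pm_one R)) _ (conj_hom t)).
  exact: conj_hom_continuous.
move=> g g' /eqP gg'E; have gg' : pm_one_set (g^-1 * g')%g.
  by apply/(@cosetP _ (pm_one R))/eqP; exact: gg'E.
apply/eqP; apply: HomSpace_eq => x /=.
by rewrite -(pm_one_conj_id (word_hom t x ^ g)%g gg') -conjgM mulVKg.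
Qed.

Lemma PU2_compact : compact [set: PU2 R].
Proof.
have -> : [set: PU2 R] = (\pi_(PU2 R) : SU2 -> PU2 R) @` [set: SU2].
  by rewrite eqEsubset; split=> // c _; exists (repr c) => //; exact: reprK.
apply: continuous_compact; last exact: su2_compact.
by apply: continuous_subspaceT; exact: pi_continuous.
Qed.

Definition accepted_words : pred (n.-tuple (letter m)) := fun t => accepted t.
Local Notation N := #|accepted_words|.
Local Notation X := (HomSpace (freeAbelian n) SU2).

Definition classify_at (i : option 'I_N) :
    disjoint_copies X (PU2 R) i -> HomSpace Gamma SU2 :=
  match i with
  | None => @ab_pull n q SU2 (ltnW q2)
  | Some k => conj_hom_PU2 (enum_val k)
  end.

Definition classify : disjoint_union_copies X (PU2 R) N -> HomSpace Gamma SU2 :=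
  fun x => classify_at (projT2 x).

Lemma classify_continuous : continuous classify.
Proof.
apply: sigT_continuous => -[k|]; first exact: conj_hom_PU2_continuous.
exact: ab_pull_continuous.
Qed.

Lemma disjoint_union_compact : compact [set: disjoint_union_copies X (PU2 R) N].
Proof.
apply: sigT_compact; first exact: finite_finset.
case=> [k|]; first exact: PU2_compact.
by apply: HomSpace_compact; [exact: su2_hausdorff|exact: su2_compact].
Qed.

Lemma conj_hom_noncommuting t g : accepted t -> exists i j,
  ~ commute (\val (conj_hom t g) (nil_gen i)) (\val (conj_hom t g) (nil_gen j)).
Proof.
move=> /accepted_refl[/first_isP[i [_ ji _]] /first_isP[j [nj _ _]]].
exists i, j; rewrite /= !word_hom_gen => c.
move: nj => /(nonhalf_letterE R q2); apply.
have <- : ltr (tnth t i) = jS by apply/eqP; rewrite -(j_letterE R q2).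
by move: c; rewrite /commute -!conjMg => /conjg_inj.
Qed.

Lemma classify_inj : injective classify.
Proof.
have disj (f : X) (k : 'I_N) (c : PU2 R) : @ab_pull n q SU2 (ltnW q2) f <> conj_hom_PU2 (enum_val k) c.
  move=> e; have [i [j]] := conj_hom_noncommuting (repr c) (enum_valP k).
  by rewrite -/(conj_hom_PU2 (enum_val k) c) -e; apply; exact: ab_pull_commute.
move=> [[k|] c] [[k'|] c'] /= e.
- have eg i : (ltr (tnth (enum_val k) i) ^ repr c = ltr (tnth (enum_val k') i) ^ repr c')%g.
    have := congr1 (fun f : HomSpace Gamma SU2 => \val f (nil_gen i)) e.
    by rewrite /= !word_hom_gen.
  have eh i : (ltr (tnth (enum_val k) i) ^ (repr c * (repr c')^-1)
      = ltr (tnth (enum_val k') i))%g by rewrite conjgM eg conjgK.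
  have pm := accepted_unique q2 (enum_valP k) (enum_valP k') eh.
  have kk' : k = k'.
    apply: enum_val_inj; apply: eq_from_tnth => i; apply: (@ltr_inj R q q2).
    by rewrite -[RHS]eh pm_one_conj_id.
  rewrite -kk' in c' e eg eh pm *; congr existT.
  have [_ _ pV] := pm_one_subgroup R.
  (* Equality of cosets needs [(repr c)^-1 * repr c'], which is the inverse of the central element
     found, conjugated by [repr c']. *)
  have := pm_one_conj (repr c') (pV _ pm).
  rewrite invgM invgK conjgE -!mulgA mulKg => cc'.
  have : \pi_(quotientGroup (pm_one R)) (repr c) = \pi_(quotientGroup (pm_one R)) (repr c').
    by apply/eqP/(@cosetP _ (pm_one R)).
  by rewrite !reprQ.
- by case: (disj c' k c (esym e)).
- by case: (disj c k' c' e).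
- by congr existT; exact: (ab_pull_inj e).
Qed.

Lemma classify_surj f : exists x, classify x = f.
Proof.
have [fC|fN] := pselect (forall i j, commute (\val f (nil_gen i)) (\val f (nil_gen j))).
  have [f' f'E] := ab_pull_surj (ltnW q2) fC.
  by exists (existT _ None f').
pose phi (w : freeGroup n) : SU2 := \val f (\pi_Gamma w).
have phiM : {morph phi : x y / (x * y)%g}.
  by move=> x y; rewrite /phi (@piM_quot _ (lcs (freeGroup n) q.+1)) (set_valP f).
have phiq (w : freeGroup n) : lcs_set q.+1 w -> phi w = 1%g.
  move=> lw; rewrite -(morph1g phiM); congr (\val f _); apply/esym/eqP/cosetP.
  by rewrite invg1 mul1g.
have [i [j cN]] : exists i j, ~ commute (phi (free_gen i)) (phi (free_gen j)).
  apply: contrapT => nex; apply: fN => i j; apply: contrapT => cN.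
  by apply: nex; exists i, j.
have [h [t [ht tr tn]]] := exists_refl_form q2 phiM phiq (ex_intro _ i (ex_intro _ j cN)).
have [h' [t' [t'a ht']]] := exists_accepted q2 ht tr tn.
(* Conjugation by [h'] leads from [f] to the normal form, so the point of the orbit is its
   inverse. *)
pose c : PU2 R := \pi_(quotientGroup (pm_one R)) h'^-1%g.
exists (existT _ (Some (enum_rank_in (A := accepted_words) t'a t')) c); apply: HomSpace_eq.
apply: (nil_hom_ext (conj_hom_morph _ _) (set_valP f)) => k.
rewrite word_hom_gen enum_rankK_in //.
have cE := @repr_coset _ (pm_one R) h'^-1%g.
rewrite -[repr c](mulVKg h'^-1%g) conjgM (pm_one_conj_id _ cE) -ht' conjgK //.
Qed.

End Classification.

(** With [n = k + 1] and [q = p + 2] the only exponents that can be negative are [k - 1] and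
    [2k - 1]; there a factor 1/2 is split off. *)
Lemma component_countE (q n : nat) : (2 <= q)%N -> (1 <= n)%N ->
  component_count n q =
  (8 ^+ n - 3 * 4 ^+ n + 2 * 2 ^+ n) / 24
  + (2 ^+ n - 1) * ((4 * (2 ^ (q - 2))%:R) ^+ n / (4 * (2 ^ (q - 2))%:R) - 4 ^+ n / 4) / 2.
Proof.
case: n => // k; case: q => [|[|p]] // _ _; rewrite /component_count !subSS subn0.
have -> : k.+1%:Z - 2 = k%:Z - 1 by lia.
have -> : k.+1%:Z - 1 = k%:Z by lia.
have -> : p.+2%:Z - 2 = p%:Z by lia.
have -> : 2 * k.+1%:Z - 3 = (k + k)%:Z - 1 by lia.
have two0 : (2 : rat) != 0 by [].
have e1 : (2 : rat) ^ (-1) = 2^-1 by [].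
have e4 : (4 : rat) ^+ k = 2 ^+ k * 2 ^+ k by rewrite -exprMn.
have e8 : (8 : rat) ^+ k = 2 ^+ k * 2 ^+ k * 2 ^+ k by rewrite -!exprMn.
rewrite !expfzDr // e1 -PoszM -!exprnP !exprS natrX exprMn e4 e8 -exprM !exprD.
have p0 : (2 : rat) ^+ p != 0 by rewrite expf_neq0.
by field.
Qed.

Unset Implicit Arguments.

Theorem corollary1 (R : realType) (q n : nat)
    (hq : (2 <= q)%N) (hn : (1 <= n)%N) :
  exists N : nat,
    N%:R = component_count n q /\
    homeomorphic
      (HomSpace (quotientGroup (lcs (freeGroup n) q.+1)) (SU R 2))
      (disjoint_union_copies (HomSpace (freeAbelian n) (SU R 2)) (PU2 R) N).
Proof.
exists #|@accepted_words q n|; split; last first.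
  apply/homeomorphic_sym/(@continuous_bij_homeo _ _ (@classify R q n hq)).
  - exact: disjoint_union_compact.
  - by apply: HomSpace_hausdorff; exact: su2_hausdorff.
  - exact: classify_continuous.
  - exact: classify_inj.
  - exact: classify_surj.
have -> : #|@accepted_words q n| = word_count (@accepted (2 ^ (q - 2))) n.
  rewrite -sum1_card big_mkcond; apply: eq_bigr => t _.
  by rewrite unfold_in /accepted_words; case: accepted.
by rewrite (word_count_accepted (m_gt0 q)) component_countE.
Qed.
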